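(* Let $t\in\mathbb{Z}_{\geq 1}$, let $\eta\in\mathbb{C}$, and let $\mathcal{I}_{\infty,\eta}=i_{\infty+}(\mathcal{O}_{U_\infty,\eta})$ be the standard $\eta$-twisted Harish-Chandra sheaf for $\mathcal{D}_t$ on $X=\mathbb{CP}^1$. Then, as modules over $\mathfrak{g}=\mathfrak{sl}(2,\mathbb{C})$, \[ \Gamma(X,\mathcal{I}_{\infty,\eta})\simeq Y(\eta,t), \] where $Y(\eta,t)$ is the irreducible $\eta$-Whittaker module of infinitesimal character $\chi:\Omega\mapsto (t-1)^2+2(t-1)$.
   Context: Let $\mathfrak{g}=\mathfrak{sl}(2,\mathbb{C})$ with standard basis $E=\begin{pmatrix}0&1\\0&0\end{pmatrix}$, $H=\begin{pmatrix}1&0\\0&-1\end{pmatrix}$, $F=\begin{pmatrix}0&0\\1&0\end{pmatrix}$, $\mathfrak{n}=\mathbb{C}E$, $G=\mathrm{SL}(2,\mathbb{C})$. The Casimir element is $\Omega=H^2+2EF+2FE$, which generates the center $\mathcal{Z}(\mathfrak{g})$ of $\mathcal{U}(\mathfrak{g})$. Whittaker modules. A number $\eta\in\mathbb{C}$ is identified with the Lie algebra character $\mathfrak{n}\to\mathbb{C}$, $E\mapsto\eta$. An $\eta$-Whittaker vector in a $\mathfrak{g}$-module is a vector $v$ with $E\cdot v=\eta v$, and an $\eta$-Whittaker module is a $\mathfrak{g}$-module generated by an $\eta$-Whittaker vector. A module has infinitesimal character $\chi:\mathcal{Z}(\mathfrak{g})\to\mathbb{C}$ if $\mathcal{Z}(\mathfrak{g})$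 acts on it by $\chi$. Flag variety. $X=\mathbb{CP}^1$ with points $[x_0:x_1]$; $G$ acts by $\begin{pmatrix}a&b\\c&d\end{pmatrix}\cdot[x_0:x_1]=[ax_0+bx_1:cx_0+dx_1]$. Put $0=[1:0]$, $\infty=[0:1]$, $U_0=X\setminus\{\infty\}$ with coordinate $z=x_1/x_0$, $U_\infty=X\setminus\{0\}$ with coordinate $w=x_0/x_1$, and $V=U_0\cap U_\infty\simeq\mathbb{C}^\times$, on which $w=1/z$. For $U$ affine open, $D(U)$ is its ring of differential operators. The sheaf $\mathcal{D}_t$. For $t\in\mathbb{Z}$, let $\mathcal{O}(t-1)$ be the line bundle whose sections over $U$ are homogeneous functions of degree $t-1$ on the preimage of $U$ in $\mathbb{C}^2\setminus\{0\}$, trivialized by $f\mapsto f(1,z)$ on $U_0$ and $f\mapsto f(w,1)$ on $U_\infty$ (so a section given by $q(w)$ on $U_\infty$ is given by $z^{t-1}q(1/z)$ on $U_0$). $\mathcal{D}_t$ is the sheaf of differential endomorphisms of $\mathcal{O}(t-1)$. The trivializations identify $\mathcal{D}_t|_{U_0}$ with $\mathcal{D}_{U_0}$ and $\mathcal{D}_t|_{U_\infty}$ with $\mathcal{D}_{U_\infty}$; over $V$ the two identifications differ by the ring automorphism $T\mapsto z^{t-1}Tz^{-(t-1)}$ of $D(V)$ (from the $U_\infty$ to the $U_0$ description). Differentiating the $G$-action $(g\cdot f)(x)=f(g^{-1}x)$ gives an algebra homomorphism $\mathcal{U}(\mathfrak{g})\to\Gamma(X,\mathcal{D}_t)$, under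 which $E,F,H$ map to the following operators. On $U_0$: $E_0=z^2\partial_z-z(t-1)$, $F_0=-\partial_z$, $H_0=2z\partial_z-(t-1)$. On $U_\infty$: $E_\infty=-\partial_w$, $F_\infty=w^2\partial_w-w(t-1)$, $H_\infty=-2w\partial_w+(t-1)$. Through this homomorphism the global sections of any $\mathcal{D}_t$-module form a $\mathfrak{g}$-module. The sheaf $\mathcal{I}_{\infty,\eta}$. $\mathcal{O}_{U_\infty,\eta}$ is the sheaf $\mathcal{O}_{U_\infty}$ with the twisted $\mathcal{D}_{U_\infty}$-module structure determined on global sections $\mathbb{C}[w]$ by $w\cdot w^k=w^{k+1}$ and $\partial_w\cdot w^k=kw^{k-1}-\eta w^k$. It is a $\mathcal{D}_t|_{U_\infty}$-module via $\mathcal{D}_t|_{U_\infty}=\mathcal{D}_{U_\infty}$. Let $i_\infty:U_\infty\hookrightarrow X$ be the inclusion; $\mathcal{I}_{\infty,\eta}=i_{\infty+}(\mathcal{O}_{U_\infty,\eta})$ is the $\mathcal{D}_t$-module direct image, which, $i_\infty$ being an open immersion of an affine subset, is the sheaf-theoretic direct image with its induced $\mathcal{D}_t$-module structure.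
   Formalization: The formal theorem assumes η ≠ 0; for η = 0 the claim fails for every t ≥ 1, since the global sections ℂ[w] have the proper submodule spanned by 1, w, …, w^{t-1}, and the irreducible 0-Whittaker module with this infinitesimal character is not unique. *)

(* Defs.v *)
From HB Require Import structures.
From mathcomp Require Import all_boot all_order all_algebra.
From mathcomp Require Import fraction generic_quotient.
From mathcomp Require Import boolp classical_sets functions reals.
From mathcomp Require Import complex.
From mathcomp Require Import ring zify.
Set Implicit Arguments. Unset Strict Implicit. Unset Printing Implicit Defensive.
Import Order.TTheory GRing.Theory Num.Theory.
Local Open Scope classical_set_scope.
Local Open Scope ring_scope.
Local Open Scope quotient_scope.

(* The function field of the projective line: rational functions in the
   coordinate w = x0 / x1. *)
Definition ratfun (C : numClosedFieldType) := {fraction {poly C}}.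
HB.instance Definition _ (C : numClosedFieldType) := GRing.Field.on (ratfun C).

Section FunctionField.
Variable C : numClosedFieldType.
Implicit Types (p q : {poly C}) (f g : ratfun C).

Definition rat_poly p : ratfun C := FracField.tofrac p.
HB.instance Definition _ := GRing.RMorphism.copy rat_poly (@FracField.tofrac {poly C}).

Definition rat_scale (c : C) f : ratfun C := rat_poly c%:P * f.

Fact rat_scaleA a b f : rat_scale a (rat_scale b f) = rat_scale (a * b) f.
Proof. by rewrite /rat_scale polyCM rmorphM mulrA. Qed.
Fact rat_scale1 : left_id 1 rat_scale.
Proof. by move=> f; rewrite /rat_scale rmorph1 mul1r. Qed.
Fact rat_scaleDr : right_distributive rat_scale +%R.
Proof. by move=> c f g; rewrite /rat_scale mulrDr. Qed.
Fact rat_scaleDl f : {morph rat_scale^~ f : a b / a + b}.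
Proof. by move=> a b; rewrite /rat_scale polyCD rmorphD mulrDl. Qed.
HB.instance Definition _ := GRing.Zmodule_isLmodule.Build C (ratfun C)
  rat_scaleA rat_scale1 rat_scaleDr rat_scaleDl.
Fact rat_scaleAl (c : C) f g : c *: (f * g) = c *: f * g.
Proof. exact: mulrA. Qed.
HB.instance Definition _ := GRing.Lmodule_isLalgebra.Build C (ratfun C) rat_scaleAl.
Fact rat_scaleAr (c : C) f g : c *: (f * g) = f * (c *: g).
Proof. by rewrite mulrC rat_scaleAl mulrC. Qed.
HB.instance Definition _ := GRing.Lalgebra_isAlgebra.Build C (ratfun C) rat_scaleAr.

Lemma rat_scaleE (c : C) f : c *: f = rat_poly c%:P * f. Proof. by []. Qed.

Definition rat_w : ratfun C := rat_poly 'X.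

Lemma rat_poly_eq0 p : (rat_poly p == 0) = (p == 0).
Proof. exact: tofrac_eq0. Qed.

(* The derivation d/dw; it does not depend on the representative (rat_derivE). *)
Definition rat_deriv f : ratfun C :=
  let x := repr f in
  rat_poly ((\n_x)^`() * \d_x - \n_x * (\d_x)^`()) / rat_poly (\d_x ^+ 2).

Lemma rat_repr f : f = rat_poly \n_(repr f) / rat_poly \d_(repr f).
Proof.
have := reprK f; case: (repr f) => [[n d] /= hd] <-.
apply: (@mulIf _ (rat_poly d)); first by rewrite rat_poly_eq0.
rewrite mulfVK ?rat_poly_eq0 // /rat_poly; unlock FracField.tofrac.
rewrite -[LHS]FracField.pi_mul; apply/eqmodP.
by rewrite /= FracField.equivfE /FracField.mulf /= !numden_Ratio ?mulr1 ?oner_neq0 //= mulrC.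
Qed.

Lemma rat_frac_eq p q p' q' : q != 0 -> q' != 0 ->
  (rat_poly p / rat_poly q == rat_poly p' / rat_poly q') = (p * q' == p' * q).
Proof.
move=> hq hq'; rewrite eqr_div ?rat_poly_eq0 // -!rmorphM.
exact: tofrac_eq.
Qed.

Lemma rat_derivE p q : q != 0 ->
  rat_deriv (rat_poly p / rat_poly q) =
  rat_poly (p^`() * q - p * q^`()) / rat_poly (q ^+ 2).
Proof.
move=> hq.
suff key n d : d != 0 -> rat_poly p / rat_poly q = rat_poly n / rat_poly d ->
    rat_poly (n^`() * d - n * d^`()) / rat_poly (d ^+ 2) =
    rat_poly (p^`() * q - p * q^`()) / rat_poly (q ^+ 2).
  by apply: key; [apply: denom_ratioP | apply: rat_repr].
move=> hd /eqP; rewrite rat_frac_eq // => /eqP e.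
have := congr1 deriv e; rewrite !derivM => e'.
apply/eqP; rewrite rat_frac_eq ?expf_neq0 //; apply/eqP.
suff : (n^`() * d - n * d^`()) * q ^+ 2 - (p^`() * q - p * q^`()) * d ^+ 2 = 0.
  by move/eqP; rewrite subr_eq0 => /eqP.
have -> : (n^`() * d - n * d^`()) * q ^+ 2 - (p^`() * q - p * q^`()) * d ^+ 2 =
  (n^`() * q + n * q^`() - (p^`() * d + p * d^`())) * (d * q)
  + (p * d - n * q) * (d * q^`() + d^`() * q) by ring.
by rewrite e' e !subrr !mul0r addr0.
Qed.

Lemma rat_ind (P : ratfun C -> Prop) :
  (forall p q, q != 0 -> P (rat_poly p / rat_poly q)) -> forall f, P f.
Proof. by move=> hP f; rewrite (rat_repr f); apply/hP/denom_ratioP. Qed.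

Lemma rat_deriv_poly p : rat_deriv (rat_poly p) = rat_poly p^`().
Proof.
rewrite -[rat_poly p]divr1 -(rmorph1 rat_poly) rat_derivE ?oner_neq0 //.
by rewrite expr1n rmorph1 !divr1 derivC mulr0 subr0 mulr1.
Qed.

Lemma rat_derivM f g : rat_deriv (f * g) = rat_deriv f * g + f * rat_deriv g.
Proof.
elim/rat_ind: f => p q hq; elim/rat_ind: g => p' q' hq'.
rewrite mulf_div -!rmorphM !rat_derivE ?mulf_neq0 // !mulf_div addf_div -!rmorphM;
  rewrite ?rat_poly_eq0 ?mulf_neq0 ?expf_neq0 //.
rewrite -rmorphD; apply/eqP; rewrite rat_frac_eq ?mulf_neq0 ?expf_neq0 //.
by rewrite !derivM; apply/eqP; ring.
Qed.

Lemma rat_deriv_is_linear : linear rat_deriv.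
Proof.
move=> c f g; rewrite rat_scaleE.
have dD f1 g1 : rat_deriv (f1 + g1) = rat_deriv f1 + rat_deriv g1.
  elim/rat_ind: f1 => p q hq; elim/rat_ind: g1 => p' q' hq'.
  rewrite addf_div ?rat_poly_eq0 // -!rmorphM -rmorphD !rat_derivE ?mulf_neq0 //.
  rewrite addf_div ?rat_poly_eq0 ?expf_neq0 // -!rmorphM -rmorphD.
  apply/eqP; rewrite rat_frac_eq ?mulf_neq0 ?expf_neq0 //.
  by rewrite !(derivM, derivD); apply/eqP; ring.
by rewrite dD rat_derivM rat_deriv_poly derivC rmorph0 mul0r add0r.
Qed.
HB.instance Definition _ :=
  GRing.isLinear.Build C (ratfun C) (ratfun C) *:%R rat_deriv rat_deriv_is_linear.

Lemma rat_deriv_w : rat_deriv rat_w = 1.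
Proof. by rewrite /rat_w rat_deriv_poly derivX rmorph1. Qed.

End FunctionField.

Section ProjectiveLine.
Variable C : numClosedFieldType.
Implicit Types (p q : {poly C}) (f g : ratfun C) (n : int) (x : C * C).

(* The binary form of degree e whose dehomogenization at x1 = 1 is q;
   meaningful when size q <= e.+1. *)
Definition bform (e : nat) q x : C :=
  \sum_(i < e.+1) q`_i * x.1 ^+ i * x.2 ^+ (e - i).

Lemma bform_affine e q x : (size q <= e.+1)%N -> x.2 != 0 ->
  bform e q x = x.2 ^+ e * q.[x.1 / x.2].
Proof.
move=> hq hx; rewrite (horner_coef_wide _ hq) mulr_sumr; apply: eq_bigr => i _.
have hi : (i <= e)%N by rewrite -ltnS.
have -> : x.2 ^+ e = x.2 ^+ (e - i) * x.2 ^+ i by rewrite -exprD subnK.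
by rewrite expr_div_n; field; rewrite expf_neq0.
Qed.

Lemma bform_origin e q x : x.2 = 0 -> bform e q x = q`_e * x.1 ^+ e.
Proof.
move=> hx; rewrite /bform (bigD1 ord_max) //= subnn expr0 mulr1 big1 ?addr0 //.
move=> i; rewrite -val_eqE /= hx => hi.
by rewrite expr0n subn_eq0 leqNgt ltn_neqAle hi -ltnS ltn_ord mulr0.
Qed.

Lemma bformM d e p q x : (size p <= d.+1)%N -> (size q <= e.+1)%N ->
  bform (d + e) (p * q) x = bform d p x * bform e q x.
Proof.
move=> hp hq; have hpq : (size (p * q)%R <= (d + e).+1)%N.
  by have := size_polyMleq p q; lia.
have [x0|x0] := eqVneq x.2 0; last first.
  by rewrite !bform_affine // hornerM exprD; ring.
rewrite !bform_origin // exprD coefM.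
have hd : (d < (d + e).+1)%N by lia.
rewrite (bigD1 (Ordinal hd)) //= addKn big1 ?addr0; first by ring.
move=> i; rewrite -val_eqE /= => hi.
have [lt|ge] := ltnP d i; first by rewrite [p`_ _]nth_default ?mul0r // (leq_trans hp).
rewrite [q`_ _]nth_default ?mulr0 // (leq_trans hq) //.
have {ge}ge : (i < d)%N by rewrite ltn_neqAle hi.
by move: (nat_of_ord i) ge => k; lia.
Qed.

(* Nonempty Zariski-open subsets U of the projective line, given by their
   preimages in C^2 \ {0}: every such U is the complement of the zero set of a
   single nonzero binary form.  Since the line is irreducible, nonempty opens
   are stable under finite intersections, and a sheaf (which is 0 on the empty
   set) is determined by its restriction to them. *)
Definition zariski_open (U : set (C * C)) : Prop :=
  exists e q, [/\ (size q <= e.+1)%N, q != 0 &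
    U = [set x | x != 0 /\ bform e q x != 0]].

Record zopen := ZOpen { zopen_set :> set (C * C); zopenP : zariski_open zopen_set }.

Lemma zopenI_proof (U V : zopen) : zariski_open (U `&` V).
Proof.
have [d [p [hp p0 ->]]] := zopenP U; have [e [q [hq q0 ->]]] := zopenP V.
exists (d + e)%N, (p * q); split; [|by rewrite mulf_neq0|].
  by have := size_polyMleq p q; lia.
apply/seteqP; split=> x /=; rewrite bformM // mulf_eq0 negb_or.
  by case=> -[-> ->] [_ ->].
by case=> -> /andP[-> ->].
Qed.
Definition zopenI U V := ZOpen (zopenI_proof U V).

Lemma zopen_nonempty (U : zopen) : exists x, zopen_set U x.
Proof.
have [e [q [hq q0 ->]]] := zopenP U.
have [a ha] : exists a, q.[a] != 0.
  apply: contrapT => /forallNP h.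
  pose rs := [seq (i%:R : C) | i <- iota 0 (size q)].
  have := @max_poly_roots _ q rs q0; rewrite size_map size_iota ltnn.
  case/(_ _ _)/notF => //.
    by apply/allP => a _; apply: contrapT => /negP /h.
  by rewrite map_inj_uniq ?iota_uniq // => i j /eqP; rewrite eqr_nat => /eqP.
exists (a, 1); split; first by rewrite xpair_eqE oner_eq0 andbF.
by rewrite bform_affine //= ?oner_neq0 // divr1 expr1n mul1r.
Qed.

Lemma zopenX_proof : zariski_open [set x | x != 0].
Proof.
exists 0%N, 1; rewrite size_poly1 oner_neq0; split=> //.
apply/seteqP; split=> x /=; last by case.
by move=> ->; rewrite /bform big_ord1 coef1 !mul1r oner_neq0.
Qed.
Definition zopenX := ZOpen zopenX_proof.

(* U_infty, the complement of the point [1:0]. *)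
Lemma zopen_infty_proof : zariski_open [set x | x.2 != 0].
Proof.
exists 1%N, 1; rewrite size_poly1 oner_neq0; split=> //.
have e x : bform 1 1 x = x.2 by rewrite /bform !big_ord_recr big_ord0 /= !coef1 /=; ring.
apply/seteqP; split=> x /=; rewrite e; last by case.
by move=> hx; split=> //; apply: contraNneq hx => ->.
Qed.
Definition zopen_infty := ZOpen zopen_infty_proof.

(* A homogeneous rational function h(x0,x1) of degree n is encoded by
   f(w) = h(w,1).  It is regular at [x0:x1] when h = P / Q for binary forms P, Q
   with deg P - deg Q = n and Q(x0,x1) != 0. *)
Definition regular_at n x f : Prop :=
  exists d e p q, [/\ (size p <= d.+1)%N /\ (size q <= e.+1)%N,
    d%:Z = e%:Z + n, bform e q x != 0 & f = rat_poly p / rat_poly q].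

(* The sections of O(n) over U, trivialized by h |-> h(w,1). *)
Definition Osec n (U : set (C * C)) : set (ratfun C) :=
  [set f | forall x, U x -> regular_at n x f].

Lemma bform_neq0 e q x : bform e q x != 0 -> q != 0.
Proof.
apply: contraNneq => ->; rewrite /bform big1 // => i _.
by rewrite coef0 !mul0r.
Qed.

Lemma bform_exists e x : x != 0 ->
  exists q, (size q <= e.+1)%N /\ bform e q x != 0.
Proof.
move=> hx; have [x0|x0] := eqVneq x.2 0.
  exists 'X^e; rewrite size_polyXn; split=> //.
  rewrite bform_origin // coefXn eqxx mul1r expf_neq0 //.
  by apply: contraNneq hx => x1; rewrite [x]surjective_pairing x0 x1.
exists 1; rewrite size_poly1; split=> //.
by rewrite bform_affine ?size_poly1 // hornerC mulr1 expf_neq0.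
Qed.

Lemma regular_at0 n x : x != 0 -> regular_at n x 0.
Proof.
move=> hx; have [q [hq q0]] := bform_exists `|n|%N hx.
exists (`|(`|n|%N%:Z + n)%R|)%N, `|n|%N, 0, q.
by rewrite size_poly0 rmorph0 mul0r; split=> //; lia.
Qed.

Lemma regular_atM n m x f g :
  regular_at n x f -> regular_at m x g -> regular_at (n + m) x (f * g).
Proof.
case=> [d [e [p [q [[hp hq] hd q0 ->]]]]] [d' [e' [p' [q' [[hp' hq'] hd' q0' ->]]]]].
exists (d + d')%N, (e + e')%N, (p * p'), (q * q'); split.
- by have := size_polyMleq p p'; have := size_polyMleq q q'; split; lia.
- by lia.
- by rewrite bformM // mulf_neq0.
- by rewrite mulf_div -!rmorphM.
Qed.

Lemma regular_atD n x f g :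
  regular_at n x f -> regular_at n x g -> regular_at n x (f + g).
Proof.
case=> [d [e [p [q [[hp hq] hd q0 ->]]]]] [d' [e' [p' [q' [[hp' hq'] hd' q0' ->]]]]].
exists (d + e')%N, (e + e')%N, (p * q' + p' * q), (q * q'); split.
- have hN : (d + e' = d' + e)%N by lia.
  split; last by have := size_polyMleq q q'; lia.
  apply: leq_trans (size_polyD _ _) _; rewrite geq_max; apply/andP; split.
    by have := size_polyMleq p q'; lia.
  by have := size_polyMleq p' q; lia.
- by lia.
- by rewrite bformM // mulf_neq0.
- by rewrite addf_div ?rat_poly_eq0 ?(bform_neq0 q0) ?(bform_neq0 q0') // -!rmorphM -rmorphD.
Qed.

Lemma regular_at_const (c : C) x : regular_at 0 x (rat_poly c%:P).
Proof.
exists 0%N, 0%N, c%:P, 1; rewrite rmorph1 divr1 size_poly1 size_polyC_leq1.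
by rewrite /bform big_ord1 coef1 !mulr1 oner_neq0.
Qed.

Lemma regular_atZ n (c : C) x f : regular_at n x f -> regular_at n x (c *: f).
Proof. by move=> h; rewrite rat_scaleE -[n]add0r; apply/regular_atM/h/regular_at_const. Qed.

Lemma regular_at_w x : x.2 != 0 -> regular_at 0 x (rat_w C).
Proof.
move=> hx; exists 1%N, 1%N, 'X, 1; rewrite size_polyX size_poly1 rmorph1 divr1.
split=> //; rewrite /bform !big_ord_recr big_ord0 /= !coef1 /=.
by rewrite !(mul0r, add0r, addr0, mul1r, mulr1).
Qed.

(* On the open set x1 != 0 all the bundles O(n) are trivialized by x1. *)
Lemma regular_at_twist n m x f : x.2 != 0 -> regular_at n x f -> regular_at m x f.
Proof.
move=> hx [d [e [p [q [[hp hq] hd q0 ->]]]]].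
pose k := `|(m - n)%R|%N; pose l := `|(k%:Z - (m - n))%R|%N.
exists (d + k)%N, (e + l)%N, p, q; split=> //; first by split; lia.
  by rewrite /l /k; lia.
have hq' : (size q <= (e + l).+1)%N by lia.
move: q0; rewrite !bform_affine // !mulf_eq0 !expf_eq0 (negbTE hx) !andbF.
by [].
Qed.

Lemma zopenX_neq0 (U : zopen) x : zopen_set U x -> x != 0.
Proof. by have [e [q [_ _ ->]]] := zopenP U; case. Qed.

Lemma Osec0 n (U : zopen) : Osec n U 0.
Proof. by move=> x /zopenX_neq0 /regular_at0. Qed.

Lemma OsecD n U f g : Osec n U f -> Osec n U g -> Osec n U (f + g).
Proof. by move=> hf hg x hx; apply: regular_atD; [apply: hf|apply: hg]. Qed.

Lemma OsecZ n U (c : C) f : Osec n U f -> Osec n U (c *: f).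
Proof. by move=> hf x hx; apply/regular_atZ/hf. Qed.

Lemma OsecM n m U f g : Osec n U f -> Osec m U g -> Osec (n + m) U (f * g).
Proof. by move=> hf hg x hx; apply: regular_atM; [apply: hf|apply: hg]. Qed.

Lemma Osec_sub n (U V : set (C * C)) f : V `<=` U -> Osec n U f -> Osec n V f.
Proof. by move=> h hf x /h /hf. Qed.

Lemma Osec_twist n m (U : set (C * C)) f :
  U `<=` [set x | x.2 != 0] -> Osec n U f -> Osec m U f.
Proof. by move=> h hf x hx; apply: regular_at_twist (hf x hx); apply: h. Qed.

Definition Osec_pred n (U : zopen) : pred (ratfun C) := fun f => `[< Osec n U f >].

Fact Osec_submod n U : submod_closed (Osec_pred n U).
Proof.
split; first by apply/asboolP/Osec0.
by move=> c f g /asboolP hf /asboolP hg; apply/asboolP/OsecD/hg/OsecZ.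
Qed.
HB.instance Definition _ n U :=
  GRing.isSubmodClosed.Build C (ratfun C) (Osec_pred n U) (@Osec_submod n U).

Record Osections n (U : zopen) :=
  OSections { Oval :> ratfun C; _ : Oval \in Osec_pred n U }.
HB.instance Definition _ n U := [isSub for @Oval n U].
HB.instance Definition _ n U := [Choice of Osections n U by <:].
HB.instance Definition _ n U := [SubChoice_isSubLmodule of Osections n U by <:].

Lemma OvalP n U (s : Osections n U) : Osec n U s.
Proof. by case: s => f /= /asboolP. Qed.

End ProjectiveLine.

Section DifferentialOperators.
Variable C : numClosedFieldType.
Local Notation F := (ratfun C).
Implicit Types (f g : F) (S T : F -> F) (eta : C) (n : int).

Definition opcomm f T : F -> F := fun g => f * T g - T (f * g).

(* T is a differential operator (in the sense of Grothendieck) of order < k. *)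
Fixpoint op_order_lt (k : nat) T : Prop :=
  if k is k'.+1 then forall f, op_order_lt k' (opcomm f T) else forall g, T g = 0.

(* The sections over U of the sheaf of differential endomorphisms of O(n).  An
   endomorphism of the sheaf O(n)|_U is a compatible family of endomorphisms of
   the spaces O(n)(W), W nonempty open in U.  All restriction maps are
   inclusions in the function field F, which is the union of the O(n)(W), so
   such a family is the same as one endomorphism T of F preserving each of
   them; restricting the endomorphism to a smaller open set does not change T.
   For n = 0 this is the sheaf D_X. *)
Definition diffop n (U : set (C * C)) T : Prop :=
  [/\ linear T, exists k, op_order_lt k T &
      forall W : zopen C, W `<=` U -> forall f, Osec n W f -> Osec n W (T f)].

(* The twist T |-> e^(eta w) T e^(- eta w) = sum_k eta^k / k! ad(w)^k (T), a
   finite sum for a differential operator T.  It is the identity on functions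
   and sends d/dw to d/dw - eta; see op_twist_mul and op_twist_deriv. *)
Definition op_bound T : nat := xget 0%N [set k | op_order_lt k T].
Definition op_twist eta T : F -> F := fun g =>
  \sum_(k < op_bound T) (eta ^+ k / k`!%:R) *: iter k (opcomm (rat_w C)) T g.

Lemma opcomm_linear f T : linear T -> linear (opcomm f T).
Proof.
move=> hT c g h; rewrite /opcomm hT !mulrDr -!scalerAr hT scalerBr opprD.
by rewrite addrACA.
Qed.

Lemma linear_0 T : linear T -> T 0 = 0.
Proof. by move=> hT; have := hT (-1) 0 0; rewrite scaler0 addr0 scaleN1r addNr. Qed.

Lemma linear_D T : linear T -> {morph T : g h / g + h}.
Proof. by move=> hT g h; have := hT 1 g h; rewrite !scale1r. Qed.

Lemma linear_Z T c g : linear T -> T (c *: g) = c *: T g.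
Proof. by move=> hT; have := hT c g 0; rewrite (linear_0 hT) !addr0. Qed.

Lemma linear_N T : linear T -> {morph T : g / - g}.
Proof. by move=> hT g; rewrite -scaleN1r linear_Z // scaleN1r. Qed.

Lemma linear_sum T (I : Type) (r : seq I) (P : pred I) (G : I -> F) : linear T ->
  T (\sum_(i <- r | P i) G i) = \sum_(i <- r | P i) T (G i).
Proof. by move=> hT; apply: big_morph; [apply: linear_D | apply: linear_0]. Qed.

Lemma op_order_ltS k T : op_order_lt k T -> op_order_lt k.+1 T.
Proof.
elim: k T => [|k IH] T h; last by move=> f; apply/IH/h.
by move=> f g; rewrite /opcomm !h mulr0 subr0.
Qed.

Lemma op_order_ltW j k T : (j <= k)%N -> op_order_lt j T -> op_order_lt k T.
Proof. by move/subnK <-; elim: (k - j)%N => // m IH /IH; apply: op_order_ltS. Qed.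

Lemma opcommD f S T : opcomm f (S \+ T) = opcomm f S \+ opcomm f T.
Proof. by apply/funext => g; rewrite /opcomm /= mulrDr opprD addrACA. Qed.

Lemma opcommZ f c T : opcomm f (c \*: T) = c \*: opcomm f T.
Proof. by apply/funext => g; rewrite /opcomm /= -scalerAr scalerBr. Qed.

Lemma op_order_ltD k S T :
  op_order_lt k S -> op_order_lt k T -> op_order_lt k (S \+ T).
Proof.
elim: k S T => [|k IH] S T hS hT; first by move=> g; rewrite /= hS hT addr0.
by move=> f; rewrite opcommD; apply: IH.
Qed.

Lemma op_order_ltZ k c T : op_order_lt k T -> op_order_lt k (c \*: T).
Proof.
elim: k T => [|k IH] T hT; first by move=> g; rewrite /= hT scaler0.
by move=> f; rewrite opcommZ; apply: IH.
Qed.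

Lemma opcomm_comp f S T : linear S ->
  opcomm f (S \o T) = (opcomm f S \o T) \+ (S \o opcomm f T).
Proof.
move=> hS; apply/funext => g; rewrite /opcomm /= (linear_D hS) (linear_N hS).
by rewrite addrA subrK.
Qed.

Lemma op_order_lt_comp j k S T : linear S -> linear T ->
  op_order_lt j S -> op_order_lt k T -> op_order_lt (j + k) (S \o T).
Proof.
move: {2}(j + k)%N (leqnn (j + k)) => m.
elim: m j k S T => [|m IH] [|j] [|k] S T hm lS lT hS hT //.
- by move=> g; rewrite /= hT (linear_0 lS).
- by move=> g; rewrite /= hT (linear_0 lS).
- by apply: (op_order_ltW (leq0n _)) => g /=; rewrite hS.
- by apply: (op_order_ltW (leq0n _)) => g /=; rewrite hT (linear_0 lS).
rewrite addSn => f; rewrite opcomm_comp //; apply: op_order_ltD.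
  by apply: IH => //; apply: opcomm_linear.
apply: (@op_order_ltW (j.+1 + k)); first by lia.
by apply: IH => //; [lia | apply: opcomm_linear].
Qed.

Section Twist.
Variable eta : C.
Local Notation adw := (opcomm (rat_w C)).
Local Notation term T k g := ((eta ^+ k / k`!%:R) *: iter k adw T g).

Lemma iter_adw0 N k T g : op_order_lt N T -> (N <= k)%N -> iter k adw T g = 0.
Proof.
move=> hT /(op_order_ltW) /(_ hT); elim: k T {N hT} => [|k IH] T h; first exact: h.
by rewrite iterSr; apply/IH/h.
Qed.

Lemma iter_adw_linear k T : linear T -> linear (iter k adw T).
Proof. by move=> hT; elim: k => //= k; apply: opcomm_linear. Qed.

Lemma op_twistE N T g : op_order_lt N T -> op_twist eta T g = \sum_(k < N) term T k g.
Proof.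
have widen K M : op_order_lt K T -> (K <= M)%N ->
    \sum_(k < K) term T k g = \sum_(k < M) term T k g.
  move=> hK hKM; rewrite (big_ord_widen _ (fun k => term T k g) hKM) big_mkcond.
  apply: eq_bigr => i _; case: ltnP => // hi.
  by rewrite (iter_adw0 _ hK) ?scaler0.
move=> hN; have hb : op_order_lt (op_bound T) T.
  by rewrite /op_bound; apply: (@xgetPex _ 0%N [set k | op_order_lt k T]); exists N.
rewrite /op_twist (widen _ (maxn (op_bound T) N)) ?leq_maxl //.
by rewrite -(widen N) ?leq_maxr.
Qed.

Lemma op_twist_linear T : linear T -> linear (op_twist eta T).
Proof.
move=> hT c g h; rewrite /op_twist scaler_sumr -big_split; apply: eq_bigr => k _ /=.
by rewrite iter_adw_linear // scalerDr !scalerA mulrC.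
Qed.

Lemma op_twistD S T g : (exists k, op_order_lt k S) -> (exists k, op_order_lt k T) ->
  op_twist eta (S \+ T) g = op_twist eta S g + op_twist eta T g.
Proof.
move=> [j hS] [k hT]; pose m := maxn j k.
have {}hS : op_order_lt m S by apply: op_order_ltW hS; apply: leq_maxl.
have {}hT : op_order_lt m T by apply: op_order_ltW hT; apply: leq_maxr.
rewrite (op_twistE _ (op_order_ltD hS hT)) (op_twistE _ hS) (op_twistE _ hT).
rewrite -big_split; apply: eq_bigr => i _ /=; rewrite -scalerDr; congr (_ *: _).
suff -> : iter i adw (S \+ T) = iter i adw S \+ iter i adw T by [].
by elim: {i}(nat_of_ord i) => //= i ->; rewrite opcommD.
Qed.

Lemma op_twistZ c T g : (exists k, op_order_lt k T) ->
  op_twist eta (c \*: T) g = c *: op_twist eta T g.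
Proof.
move=> [k hT]; rewrite (op_twistE _ (op_order_ltZ c hT)) (op_twistE _ hT).
rewrite scaler_sumr; apply: eq_bigr => i _.
rewrite [RHS]scalerA [c * _]mulrC -[RHS]scalerA.
congr (_ *: _).
suff e (m : nat) : iter m adw (c \*: T) = c \*: iter m adw T.
  exact: (congr1 (fun h : F -> F => h g) (e i)).
by elim: m => //= m ->; rewrite opcommZ.
Qed.

Lemma op_order_lt_mul f : op_order_lt 1 ( *%R f).
Proof. by move=> g h; rewrite /opcomm mulrCA subrr. Qed.

Lemma op_twist_mul f g : op_twist eta ( *%R f) g = f * g.
Proof. by rewrite (op_twistE _ (op_order_lt_mul f)) big_ord1 expr0 fact0 divr1 scale1r. Qed.

Lemma op_order_lt_deriv : op_order_lt 2 (@rat_deriv C).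
Proof.
move=> f g h; rewrite /opcomm !rat_derivM; ring.
Qed.

Lemma op_twist_deriv g : op_twist eta (@rat_deriv C) g = rat_deriv g - eta *: g.
Proof.
rewrite (op_twistE _ op_order_lt_deriv) big_ord_recr big_ord1 /=.
rewrite expr0 expr1 fact0 !divr1 scale1r /opcomm rat_derivM rat_deriv_w mul1r.
by rewrite opprD addrCA subrr addr0 scalerN.
Qed.

Lemma op_twist_id g : op_twist eta id g = g.
Proof.
have -> : (id : F -> F) = *%R 1 by apply/funext => h; rewrite mul1r.
by rewrite op_twist_mul mul1r.
Qed.

Lemma iter_adw_comp k S T g : linear S -> linear T ->
  iter k adw (S \o T) g =
  \sum_(i < k.+1) 'C(k, i)%:R *: iter i adw S (iter (k - i) adw T g).
Proof.
move=> lS lT; elim: k g => [|k IH] g; first by rewrite big_ord1 bin0 scale1r.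
pose x i j := iter i adw S (iter j adw T g).
have hx i j : rat_w C * x i j - iter i adw S (iter j adw T (rat_w C * g)) =
    x i.+1 j + x i j.+1.
  rewrite /x /= {3}/opcomm {2}/opcomm.
  have li := iter_adw_linear i lS; rewrite (linear_D li) (linear_N li).
  by rewrite addrA subrK.
rewrite iterS {1}/opcomm !IH mulr_sumr -sumrB.
transitivity (\sum_(i < k.+1) 'C(k, i)%:R *: (x i.+1 (k - i)%N + x i (k - i).+1)).
  by apply: eq_bigr => i _; rewrite -hx scalerBr scalerAr.
under eq_bigr do rewrite scalerDr.
rewrite big_split /= [RHS]big_ord_recl /= bin0 scale1r ?subn0.
have -> : \sum_(i < k.+1) 'C(k, i)%:R *: x i (k - i).+1 =
   x 0%N k.+1 + \sum_(i < k.+1) 'C(k, i.+1)%:R *: x i.+1 (k - i)%N.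
  rewrite big_ord_recl /= bin0 scale1r ?subn0; congr (_ + _).
  rewrite [RHS]big_ord_recr /= bin_small // scale0r addr0.
  by apply: eq_bigr => i _; rewrite /bump /= add1n subnSK.
rewrite addrCA; congr (_ + _); rewrite -big_split; apply: eq_bigr => i _ /=.
by rewrite -scalerDl /bump /= add1n subSS binS natrD addrC.
Qed.

Lemma sum_triangle (V : zmodType) (u : nat -> nat -> V) K :
  (forall i j, (K <= i + j)%N -> u i j = 0) ->
  \sum_(k < K) \sum_(i < k.+1) u i (k - i)%N = \sum_(i < K) \sum_(j < K) u i j.
Proof.
move=> hu.
transitivity (\sum_(k < K) \sum_(i < K) \sum_(j < K | (i + j == k)%N) u i j).
  apply: eq_bigr => k _.
  rewrite (big_ord_widen _ (fun i => u i (k - i)%N) (ltn_ord k)) big_mkcond.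
  apply: eq_bigr => i _; rewrite ltnS; case: leqP => hi.
    have hj : (k - i < K)%N by apply: leq_ltn_trans (ltn_ord k); apply: leq_subr.
    rewrite (big_pred1 (Ordinal hj)) // => j.
    by apply/eqP/eqP => [e|->]; [apply: val_inj; rewrite /= -e addKn | rewrite /= subnKC].
  by rewrite big_pred0 // => j; apply/negbTE; rewrite neq_ltn (leq_trans hi) ?leq_addr ?orbT.
rewrite exchange_big; apply: eq_bigr => i _ /=.
under eq_bigr do rewrite big_mkcond.
rewrite exchange_big; apply: eq_bigr => j _ /=.
rewrite -big_mkcond /=; have [hK|hK] := leqP K (i + j).
  by rewrite hu // big1.
by rewrite (big_pred1 (Ordinal hK)) // => k; apply/eqP/eqP => [e|->//]; apply: val_inj.
Qed.

Lemma op_twist_comp S T g : linear S -> linear T ->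
  (exists k, op_order_lt k S) -> (exists k, op_order_lt k T) ->
  op_twist eta (S \o T) g = op_twist eta S (op_twist eta T g).
Proof.
move=> lS lT [N hS] [M hT]; rewrite (op_twistE _ (op_order_lt_comp lS lT hS hT)).
have hS' := op_order_ltW (leq_addr M N) hS; have hT' := op_order_ltW (leq_addl N M) hT.
rewrite (op_twistE _ hS') (op_twistE _ hT').
pose u i j := (eta ^+ i / i`!%:R) *:
  ((eta ^+ j / j`!%:R) *: iter i adw S (iter j adw T g)).
transitivity (\sum_(k < N + M) \sum_(i < k.+1) u i (k - i)%N).
  apply: eq_bigr => k _; rewrite iter_adw_comp // scaler_sumr.
  apply: eq_bigr => i _; rewrite /u !scalerA; congr (_ *: _).
  have hi : (i <= k)%N by rewrite -ltnS.
  have nz m : (m`!%:R : C) != 0 by rewrite pnatr_eq0 -lt0n fact_gt0.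
  rewrite -(bin_fact hi) !natrM -{1}(subnKC hi) exprD.
  have nzb : ('C(k, i)%:R : C) != 0 by rewrite pnatr_eq0 -lt0n bin_gt0.
  by field; rewrite !nz nzb.
rewrite sum_triangle => [|i j hij].
  apply: eq_bigr => i _; rewrite (linear_sum _ _ _ (iter_adw_linear i lS)).
  by rewrite scaler_sumr; apply: eq_bigr => j _; rewrite /u (linear_Z _ _ (iter_adw_linear i lS)).
rewrite /u; have [hi|hi] := leqP N i; first by rewrite (iter_adw0 _ hS) ?scaler0.
rewrite (@iter_adw0 _ _ T g hT) ?(linear_0 (iter_adw_linear i lS)) ?scaler0 //; lia.
Qed.

Lemma op_twist_Osec (U : zopen C) T f : U `<=` zopen_infty C ->
  diffop 0 U T -> Osec 0 U f -> Osec 0 U (op_twist eta T f).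
Proof.
move=> hU [_ _ hT] hf; rewrite /op_twist.
have hk k h : Osec 0 U h -> Osec 0 U (iter k adw T h).
  have hw : Osec 0 U (rat_w C) by move=> x /hU; apply: regular_at_w.
  have hwM h' : Osec 0 U h' -> Osec 0 U (rat_w C * h').
    by rewrite -{2}[0 : int]addr0; apply: OsecM.
  elim: k h => [|k IH] h hh /=; first exact: hT.
  rewrite /opcomm; apply: OsecD; first exact/hwM/IH.
  by rewrite -scaleN1r; apply/OsecZ/IH/hwM.
by elim/big_ind: _ => [|g h|i _]; [exact: Osec0 | exact: OsecD | exact/OsecZ/hk].
Qed.

End Twist.

Lemma diffop_twist n m (U : set (C * C)) T :
  U `<=` zopen_infty C -> diffop n U T -> diffop m U T.
Proof.
move=> hU [lT oT hT]; split=> // W hW f hf.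
have hWU := subset_trans hW hU.
by apply: (Osec_twist (n := n) m hWU); apply: hT => //; apply: (Osec_twist (n := m)).
Qed.

Lemma diffop_sub n (U V : set (C * C)) T : V `<=` U -> diffop n U T -> diffop n V T.
Proof. by move=> h [lT oT hT]; split=> // W hW; apply/hT/(subset_trans hW). Qed.

End DifferentialOperators.

Section Sl2.
Variable C : numClosedFieldType.

Definition tr0_pred : pred 'M[C]_2 := fun A => \tr A == 0.
Fact tr0_submod : submod_closed tr0_pred.
Proof.
split; first by rewrite unfold_in mxtrace0.
move=> c A B; rewrite !unfold_in => /eqP hA /eqP hB.
by rewrite linearP /= hA hB mulr0 addr0.
Qed.
HB.instance Definition _ :=
  GRing.isSubmodClosed.Build C 'M[C]_2 tr0_pred tr0_submod.

Record sl2 := Sl2 { sl2_mx :> 'M[C]_2; _ : sl2_mx \in tr0_pred }.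
HB.instance Definition _ := [isSub for sl2_mx].
HB.instance Definition _ := [Choice of sl2 by <:].
HB.instance Definition _ := [SubChoice_isSubLmodule of sl2 by <:].

Fact sl2_bracket_proof (x y : sl2) : (x *m y - y *m x)%R \in tr0_pred.
Proof. by rewrite unfold_in raddfB /= mxtrace_mulC subrr. Qed.
Definition sl2_bracket x y : sl2 := Sl2 (sl2_bracket_proof x y).

Fact sl2_E_proof : (delta_mx 0 1 : 'M[C]_2) \in tr0_pred.
Proof. by rewrite unfold_in /mxtrace !big_ord_recr big_ord0 !mxE /= !addr0. Qed.
Definition sl2_E := Sl2 sl2_E_proof.

Fact sl2_F_proof : (delta_mx 1 0 : 'M[C]_2) \in tr0_pred.
Proof. by rewrite unfold_in /mxtrace !big_ord_recr big_ord0 !mxE /= !addr0. Qed.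
Definition sl2_F := Sl2 sl2_F_proof.

Fact sl2_H_proof : (delta_mx 0 0 - delta_mx 1 1 : 'M[C]_2) \in tr0_pred.
Proof.
by rewrite unfold_in /mxtrace !big_ord_recr big_ord0 !mxE /= subr0 !add0r subrr.
Qed.
Definition sl2_H := Sl2 sl2_H_proof.

Record sl2_module := Sl2Module {
  sl2_carrier :> lmodType C;
  sl2_act : sl2 -> sl2_carrier -> sl2_carrier;
  sl2_act_linear : forall x, linear (sl2_act x);
  sl2_act_linear_l : forall v, linear (sl2_act^~ v);
  sl2_act_bracket : forall x y v, sl2_act (sl2_bracket x y) v =
    sl2_act x (sl2_act y v) - sl2_act y (sl2_act x v) }.

Definition sl2_submodule (M : sl2_module) (N : set M) : Prop :=
  [/\ N 0, forall (c : C) u v, N u -> N v -> N (c *: u + v) &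
      forall x v, N v -> N (sl2_act x v)].

Definition sl2_irreducible (M : sl2_module) : Prop :=
  (exists v : M, v != 0) /\
  forall N : set M, sl2_submodule N -> N = [set 0] \/ N = setT.

Definition sl2_isomorphic (M N : sl2_module) : Prop :=
  exists phi : {linear M -> N},
    bijective phi /\ forall x v, phi (sl2_act x v) = sl2_act x (phi v).

Definition whittaker_vector (eta : C) (M : sl2_module) (v : M) : Prop :=
  sl2_act sl2_E v = eta *: v.

Definition whittaker_module (eta : C) (M : sl2_module) : Prop :=
  exists v : M, whittaker_vector eta v /\
    forall N : set M, sl2_submodule N -> N v -> N = setT.

End Sl2.

Section Enveloping.
Variable C : numClosedFieldType.

(* U(sl2) by generators and relations: noncommutative polynomial expressions in
   the elements of sl2, modulo the smallest congruence that makes them a unital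
   associative C-algebra in which x |-> UGen x is linear and sends brackets to
   commutators. *)
Inductive uterm :=
| UScal of C
| UGen of sl2 C
| UAdd of uterm & uterm
| UMul of uterm & uterm.

Inductive ueq : uterm -> uterm -> Prop :=
| ueq_refl u : ueq u u
| ueq_sym u v : ueq u v -> ueq v u
| ueq_trans u v w : ueq u v -> ueq v w -> ueq u w
| ueq_add u u' v v' : ueq u u' -> ueq v v' -> ueq (UAdd u v) (UAdd u' v')
| ueq_mul u u' v v' : ueq u u' -> ueq v v' -> ueq (UMul u v) (UMul u' v')
| ueq_addA u v w : ueq (UAdd u (UAdd v w)) (UAdd (UAdd u v) w)
| ueq_addC u v : ueq (UAdd u v) (UAdd v u)
| ueq_add0 u : ueq (UAdd (UScal 0) u) u
| ueq_mulA u v w : ueq (UMul u (UMul v w)) (UMul (UMul u v) w)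
| ueq_mul1l u : ueq (UMul (UScal 1) u) u
| ueq_mulDl u v w : ueq (UMul (UAdd u v) w) (UAdd (UMul u w) (UMul v w))
| ueq_mulDr u v w : ueq (UMul w (UAdd u v)) (UAdd (UMul w u) (UMul w v))
| ueq_mul0l u : ueq (UMul (UScal 0) u) (UScal 0)
| ueq_scalD a b : ueq (UScal (a + b)) (UAdd (UScal a) (UScal b))
| ueq_scalM a b : ueq (UScal (a * b)) (UMul (UScal a) (UScal b))
| ueq_scalC a u : ueq (UMul (UScal a) u) (UMul u (UScal a))
| ueq_gen a x y :
    ueq (UGen (a *: x + y)) (UAdd (UMul (UScal a) (UGen x)) (UGen y))
| ueq_bracket x y :
    ueq (UAdd (UGen (sl2_bracket x y)) (UMul (UGen y) (UGen x)))
        (UMul (UGen x) (UGen y)).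

Definition ueqb u v := `[< ueq u v >].
Fact ueqb_refl : reflexive ueqb.
Proof. by move=> u; apply/asboolP/ueq_refl. Qed.
Fact ueqb_sym : symmetric ueqb.
Proof. by move=> u v; apply/asboolP/asboolP; apply: ueq_sym. Qed.
Fact ueqb_trans : transitive ueqb.
Proof. by move=> v u w /asboolP h /asboolP h'; apply/asboolP/(ueq_trans h h'). Qed.

HB.instance Definition _ := gen_eqMixin uterm.
HB.instance Definition _ := gen_choiceMixin uterm.
Canonical ueqb_equiv := EquivRel ueqb ueqb_refl ueqb_sym ueqb_trans.

Definition Usl2 := {eq_quot ueqb}.
HB.instance Definition _ : EqQuotient _ ueqb Usl2 := EqQuotient.on Usl2.
HB.instance Definition _ := Choice.on Usl2.

Definition umk (u : uterm) : Usl2 := \pi_Usl2 u.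

Lemma umkP u v : umk u = umk v <-> ueq u v.
Proof.
split; first by move/eqmodP/asboolP.
by move=> h; apply/eqmodP/asboolP.
Qed.

Lemma umk_repr (a : Usl2) : umk (repr a) = a. Proof. exact: reprK. Qed.

Lemma repr_umk u : ueq (repr (umk u)) u.
Proof. by apply/umkP; rewrite umk_repr. Qed.

Definition uadd (a b : Usl2) : Usl2 := umk (UAdd (repr a) (repr b)).
Definition umul (a b : Usl2) : Usl2 := umk (UMul (repr a) (repr b)).
Definition uopp (a : Usl2) : Usl2 := umk (UMul (UScal (-1)) (repr a)).
Definition uscale (c : C) (a : Usl2) : Usl2 := umk (UMul (UScal c) (repr a)).

Lemma uaddE u v : uadd (umk u) (umk v) = umk (UAdd u v).
Proof. by apply/umkP/ueq_add; apply: repr_umk. Qed.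
Lemma umulE u v : umul (umk u) (umk v) = umk (UMul u v).
Proof. by apply/umkP/ueq_mul; apply: repr_umk. Qed.
Lemma uscaleE c u : uscale c (umk u) = umk (UMul (UScal c) u).
Proof. by apply/umkP/ueq_mul; [apply: ueq_refl|apply: repr_umk]. Qed.
Lemma uoppE u : uopp (umk u) = umk (UMul (UScal (-1)) u).
Proof. exact: uscaleE. Qed.

Lemma usl2_ind (P : Usl2 -> Prop) : (forall u, P (umk u)) -> forall a, P a.
Proof. by move=> h a; rewrite -(umk_repr a). Qed.

Fact uaddA : associative uadd.
Proof.
elim/usl2_ind => u; elim/usl2_ind => v; elim/usl2_ind => w.
by rewrite !uaddE; apply/umkP/ueq_addA.
Qed.
Fact uaddC : commutative uadd.
Proof.
by elim/usl2_ind => u; elim/usl2_ind => v; rewrite !uaddE; apply/umkP/ueq_addC.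
Qed.
Fact uadd0 : left_id (umk (UScal 0)) uadd.
Proof. by elim/usl2_ind => u; rewrite uaddE; apply/umkP/ueq_add0. Qed.
Fact uaddN : left_inverse (umk (UScal 0)) uopp uadd.
Proof.
elim/usl2_ind => u; rewrite uoppE uaddE; apply/umkP.
apply: ueq_trans (ueq_mul0l u); rewrite -(addNr (1 : C)).
apply: ueq_trans (ueq_mul (ueq_sym (ueq_scalD _ _)) (ueq_refl u)).
apply: ueq_trans (ueq_sym (ueq_mulDl _ _ _)).
by apply/ueq_add/ueq_sym/ueq_mul1l/ueq_refl.
Qed.
HB.instance Definition _ := GRing.isZmodule.Build Usl2 uaddA uaddC uadd0 uaddN.

Fact umulA : associative umul.
Proof.
elim/usl2_ind => u; elim/usl2_ind => v; elim/usl2_ind => w.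
by rewrite !umulE; apply/umkP/ueq_mulA.
Qed.
Fact umul1l : left_id (umk (UScal 1)) umul.
Proof. by elim/usl2_ind => u; rewrite umulE; apply/umkP/ueq_mul1l. Qed.
Fact umul1r : right_id (umk (UScal 1)) umul.
Proof.
elim/usl2_ind => u; rewrite umulE; apply/umkP.
by apply: ueq_trans (ueq_sym (ueq_scalC 1 u)) (ueq_mul1l u).
Qed.
Fact umulDl : left_distributive umul uadd.
Proof.
elim/usl2_ind => u; elim/usl2_ind => v; elim/usl2_ind => w.
by rewrite !(uaddE, umulE); apply/umkP/ueq_mulDl.
Qed.
Fact umulDr : right_distributive umul uadd.
Proof.
elim/usl2_ind => u; elim/usl2_ind => v; elim/usl2_ind => w.
by rewrite !(uaddE, umulE); apply/umkP/ueq_mulDr.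
Qed.

(* The augmentation, which shows that U(sl2) is not the zero ring. *)
Fixpoint uaug (u : uterm) : C :=
  match u with
  | UScal c => c
  | UGen _ => 0
  | UAdd u v => uaug u + uaug v
  | UMul u v => uaug u * uaug v
  end.
Lemma uaugP u v : ueq u v -> uaug u = uaug v.
Proof.
by elim=> {u v} /=; intros; rewrite ?mul0r ?mulr0 ?addr0 ?add0r ?mul1r ?mulrDl ?mulrDr
  ?addrA ?mulrA //; (congruence || by rewrite addrC || by rewrite mulrC).
Qed.
Fact uone_neq0 : umk (UScal 1) != umk (UScal 0).
Proof. by apply/eqP => /umkP /uaugP /eqP; rewrite /= oner_eq0. Qed.
HB.instance Definition _ := GRing.Zmodule_isNzRing.Build Usl2
  umulA umul1l umul1r umulDl umulDr uone_neq0.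

Fact uscaleA a b u : uscale a (uscale b u) = uscale (a * b) u.
Proof.
elim/usl2_ind: u => u; rewrite !uscaleE; apply/umkP.
apply: ueq_trans (ueq_mulA _ _ _) _.
by apply/ueq_mul/ueq_refl/ueq_sym/ueq_scalM.
Qed.
Fact uscale1 : left_id 1 uscale.
Proof. by elim/usl2_ind => u; rewrite uscaleE; apply/umkP/ueq_mul1l. Qed.
Fact uscaleDr : right_distributive uscale +%R.
Proof.
move=> c; elim/usl2_ind => u; elim/usl2_ind => v.
rewrite -[LHS]/(uscale c (uadd _ _)) -[RHS]/(uadd _ _).
by rewrite !(uaddE, uscaleE); apply/umkP/ueq_mulDr.
Qed.
Fact uscaleDl u : {morph uscale^~ u : a b / a + b}.
Proof.
elim/usl2_ind: u => u a b; rewrite -[RHS]/(uadd _ _) !(uaddE, uscaleE); apply/umkP.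
apply: ueq_trans (ueq_mulDl _ _ _).
by apply/ueq_mul/ueq_refl/ueq_scalD.
Qed.
HB.instance Definition _ := GRing.Zmodule_isLmodule.Build C Usl2
  uscaleA uscale1 uscaleDr uscaleDl.
Fact uscaleAl (c : C) (u v : Usl2) : c *: (u * v) = c *: u * v.
Proof.
elim/usl2_ind: u => u; elim/usl2_ind: v => v.
rewrite -[LHS]/(uscale c (umul _ _)) -[RHS]/(umul (uscale c _) _).
by rewrite !(umulE, uscaleE); apply/umkP/ueq_mulA.
Qed.
HB.instance Definition _ := GRing.Lmodule_isLalgebra.Build C Usl2 uscaleAl.
Fact uscaleAr (c : C) (u v : Usl2) : c *: (u * v) = u * (c *: v).
Proof.
elim/usl2_ind: u => u; elim/usl2_ind: v => v.
rewrite -[LHS]/(uscale c (umul _ _)) -[RHS]/(umul _ (uscale c _)).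
rewrite !(umulE, uscaleE); apply/umkP.
apply: ueq_trans (ueq_mulA _ _ _) _.
apply: ueq_trans (ueq_sym (ueq_mulA _ _ _)).
by apply/ueq_mul/ueq_refl/ueq_scalC.
Qed.
HB.instance Definition _ := GRing.Lalgebra_isAlgebra.Build C Usl2 uscaleAr.

Definition uinj (x : sl2 C) : Usl2 := umk (UGen x).

Lemma uinj_linear : linear uinj.
Proof.
move=> c x y; rewrite -[RHS]/(uadd (uscale c _) _) uscaleE uaddE.
exact/umkP/ueq_gen.
Qed.

Lemma uinj_bracket x y :
  uinj (sl2_bracket x y) = uinj x * uinj y - uinj y * uinj x.
Proof.
apply/eqP; rewrite -subr_eq opprK; apply/eqP.
rewrite -[LHS]/(uadd (umk _) (umul _ _)) -[RHS]/(umul _ _) !umulE uaddE.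
exact/umkP/ueq_bracket.
Qed.

Definition casimir : Usl2 :=
  uinj (sl2_H C) ^+ 2 + 2 *: (uinj (sl2_E C) * uinj (sl2_F C))
                      + 2 *: (uinj (sl2_F C) * uinj (sl2_E C)).

Definition ucentral (z : Usl2) : Prop := forall a : Usl2, z * a = a * z.

Fixpoint uterm_act (M : sl2_module C) (u : uterm) (m : M) : M :=
  match u with
  | UScal c => c *: m
  | UGen x => sl2_act x m
  | UAdd u v => uterm_act u m + uterm_act v m
  | UMul u v => uterm_act u (uterm_act v m)
  end.
Definition usl2_act (M : sl2_module C) (a : Usl2) (m : M) : M := uterm_act (repr a) m.

Lemma uterm_act_linear (M : sl2_module C) u : linear (@uterm_act M u).
Proof.
elim: u => [c|x|u IHu v IHv|u IHu v IHv] a m n /=.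
- by rewrite scalerDr !scalerA mulrC.
- exact: sl2_act_linear.
- by rewrite IHu IHv scalerDr addrACA.
- by rewrite IHv IHu.
Qed.

Lemma uterm_actP (M : sl2_module C) u v : ueq u v -> @uterm_act M u =1 @uterm_act M v.
Proof.
elim=> {u v} /=.
- by [].
- by move=> u v _ h m.
- by move=> u v w _ h _ h' m; rewrite h.
- by move=> u u' v v' _ h _ h' m; rewrite h h'.
- by move=> u u' v v' _ h _ h' m; rewrite h' h.
- by move=> u v w m; rewrite addrA.
- by move=> u v m; rewrite addrC.
- by move=> u m; rewrite scale0r add0r.
- by [].
- by move=> u m; rewrite scale1r.
- by [].
- by move=> u v w m; have := uterm_act_linear w 1 (uterm_act u m) (uterm_act v m);
    rewrite !scale1r.
- by move=> u m; rewrite !scale0r.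
- by move=> a b m; rewrite scalerDl.
- by move=> a b m; rewrite scalerA.
- move=> a u m; have h0 : uterm_act u (0 : M) = 0.
    by have := uterm_act_linear u (-1) (0 : M) 0; rewrite scaler0 addr0 scaleN1r addNr.
  by have := uterm_act_linear u a m 0; rewrite h0 !addr0.
- by move=> a x y m; apply: sl2_act_linear_l.
- by move=> x y m; rewrite sl2_act_bracket subrK.
Qed.

Lemma usl2_act_gen (M : sl2_module C) x (m : M) : usl2_act (uinj x) m = sl2_act x m.
Proof. exact: (uterm_actP (repr_umk _)). Qed.

Lemma usl2_actM (M : sl2_module C) a b (m : M) :
  usl2_act (a * b) m = usl2_act a (usl2_act b m).
Proof. exact: (uterm_actP (repr_umk _)). Qed.

Lemma usl2_actD (M : sl2_module C) a b (m : M) :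
  usl2_act (a + b) m = usl2_act a m + usl2_act b m.
Proof. exact: (uterm_actP (repr_umk _)). Qed.

Lemma usl2_actZ (M : sl2_module C) c a (m : M) : usl2_act (c *: a) m = c *: usl2_act a m.
Proof. exact: (uterm_actP (repr_umk _)). Qed.

(* Only the restriction of chi to the center of U(sl2) matters. *)
Definition central_character (chi : Usl2 -> C) : Prop :=
  [/\ chi 1 = 1,
      forall y z, ucentral y -> ucentral z -> chi (y * z) = chi y * chi z &
      forall (c : C) y z, ucentral y -> ucentral z ->
        chi (c *: y + z) = c * chi y + chi z].

Definition has_infinitesimal_character (chi : Usl2 -> C) (M : sl2_module C) : Prop :=
  central_character chi /\
  forall z, ucentral z -> forall m : M, usl2_act z m = chi z *: m.

(* The property characterizing Y(eta, t) up to isomorphism for eta != 0.  The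
   Casimir element generates the center of U(sl2), so its image determines chi. *)
Definition is_Y (eta : C) (t : int) (M : sl2_module C) : Prop :=
  [/\ sl2_irreducible M, whittaker_module eta M &
      exists chi, chi casimir = ((t - 1) ^+ 2 + 2 * (t - 1))%:~R /\
        has_infinitesimal_character chi M].

End Enveloping.

Section DModules.
Variable C : numClosedFieldType.
Local Notation F := (ratfun C).
Implicit Types (n : int) (eta : C).

Record zopen_in (B : zopen C) :=
  ZOpenIn { zopen_in_open :> zopen C; zopen_in_sub : zopen_in_open `<=` B }.

(* A sheaf of left modules over D_n|_B on the open set B.  The ring D_n(U) is
   the set of T with [diffop n U T], under addition and composition; it contains
   O(U), acting by multiplication.  The value of [dact] on functions T that are
   not in D_n(U) is irrelevant. *)
Record dmodule n (B : zopen C) := DModule {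
  dsec : zopen_in B -> lmodType C;
  dres : forall U V : zopen_in B, V `<=` U -> {linear dsec U -> dsec V};
  dact : forall U : zopen_in B, (F -> F) -> dsec U -> dsec U;
  dres_id : forall (U : zopen_in B) (h : U `<=` U) s, dres h s = s;
  dres_comp : forall (U V W : zopen_in B) (hVU : V `<=` U) (hWV : W `<=` V) (hWU : W `<=` U) s,
    dres hWV (dres hVU s) = dres hWU s;
  dglue : forall (U : zopen_in B) (I : Type) (V : I -> zopen_in B)
      (hV : forall i, V i `<=` U) (s : forall i, dsec (V i)),
    U `<=` \bigcup_i (V i : set _) ->
    (forall i j (W : zopen_in B) (hi : W `<=` V i) (hj : W `<=` V j),
      dres hi (s i) = dres hj (s j)) ->
    exists! r : dsec U, forall i, dres (hV i) r = s i;
  dact_linear : forall (U : zopen_in B) T, diffop n U T -> linear (dact (U := U) T);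
  dactD : forall (U : zopen_in B) S T s, diffop n U S -> diffop n U T ->
    dact (U := U) (S \+ T) s = dact S s + dact T s;
  dactZ : forall (U : zopen_in B) (c : C) T s, diffop n U T ->
    dact (U := U) (c \*: T) s = c *: dact T s;
  dact1 : forall (U : zopen_in B) s, dact (U := U) id s = s;
  dactM : forall (U : zopen_in B) S T s, diffop n U S -> diffop n U T ->
    dact (U := U) (S \o T) s = dact S (dact T s);
  dact_res : forall (U V : zopen_in B) (h : V `<=` U) T s, diffop n U T ->
    dres h (dact T s) = dact T (dres h s) }.

Local Notation X := (zopenX C).
Local Notation Uoo := (zopen_infty C).

Lemma Oval_linear n (U : zopen C) (c : C) (s r : Osections n U) :
  Oval (c *: s + r) = c *: Oval s + Oval r.
Proof. by []. Qed.

Definition Ores n (U V : zopen C) (h : V `<=` U) (s : Osections n U) : Osections n V :=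
  insubd 0 (Oval s).

Lemma OresE n (U V : zopen C) (h : V `<=` U) (s : Osections n U) :
  Ores h s = s :> F.
Proof.
rewrite /Ores; apply: insubdK; apply/asboolP.
by apply: Osec_sub h _; apply: OvalP.
Qed.

Fact Ores_linear n (U V : zopen C) (h : V `<=` U) : linear (@Ores n U V h).
Proof.
by move=> c s r; apply: val_inj; rewrite linearP /= !OresE.
Qed.
HB.instance Definition _ n U V h := GRing.isLinear.Build C (Osections n U) (Osections n V)
  *:%R (@Ores n U V h) (@Ores_linear n U V h).

Section TwistedO.
Variable eta : C.

Definition tO_sec (U : zopen_in Uoo) : lmodType C := Osections 0 U.
Definition tO_res (U V : zopen_in Uoo) (h : V `<=` U) : {linear tO_sec U -> tO_sec V} :=
  @Ores 0 U V h.
Definition tO_act (U : zopen_in Uoo) (T : F -> F) (s : tO_sec U) : tO_sec U :=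
  insubd 0 (op_twist eta T (Oval s)).

Lemma tO_actE (U : zopen_in Uoo) T s : diffop 0 U T ->
  Oval (@tO_act U T s) = op_twist eta T (Oval s).
Proof.
move=> hT; apply: insubdK; apply/asboolP.
by apply: op_twist_Osec => //; [apply: zopen_in_sub | apply: OvalP].
Qed.

Fact tO_res_id (U : zopen_in Uoo) (h : U `<=` U) s : @tO_res U U h s = s.
Proof. by apply: val_inj; rewrite /= OresE. Qed.

Fact tO_res_comp (U V W : zopen_in Uoo) (hVU : V `<=` U) (hWV : W `<=` V) (hWU : W `<=` U) s :
  @tO_res V W hWV (@tO_res U V hVU s) = @tO_res U W hWU s.
Proof. by apply: val_inj; rewrite /= !OresE. Qed.

Fact zopenI_sub (B U : zopen C) (V : zopen C) : U `<=` B -> zopenI U V `<=` B.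
Proof. by move=> h x [/h]. Qed.

Fact tO_glue (U : zopen_in Uoo) (I : Type) (V : I -> zopen_in Uoo)
    (hV : forall i, V i `<=` U) (s : forall i, tO_sec (V i)) :
  U `<=` \bigcup_i (V i : set _) ->
  (forall i j (W : zopen_in Uoo) (hi : W `<=` V i) (hj : W `<=` V j),
    tO_res hi (s i) = tO_res hj (s j)) ->
  exists! r : tO_sec U, forall i, tO_res (hV i) r = s i.
Proof.
move=> hU hs.
have hij i j : Oval (s i) = Oval (s j).
  pose W := ZOpenIn (zopenI_sub (V := V j) (@zopen_in_sub _ (V i))).
  have hi : W `<=` V i by move=> x [].
  have hj : W `<=` V j by move=> x [].
  by have /(congr1 (fun r => Oval r)) := hs i j W hi hj; rewrite /= !OresE.
have [x /hU [i0 _ _]] := zopen_nonempty U.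
have hr : Oval (s i0) \in Osec_pred 0 U.
  by apply/asboolP => y /hU [i _ hy]; rewrite (hij i0 i); apply: OvalP hy.
exists (OSections hr); split=> [i|r h].
  by apply: val_inj; rewrite /= OresE /= (hij i0 i).
by apply: val_inj; rewrite /= -(h i0) /= OresE.
Qed.

Fact tO_act_linear (U : zopen_in Uoo) T : diffop 0 U T -> linear (@tO_act U T).
Proof.
move=> hT c s r; apply: val_inj; rewrite linearP /= !tO_actE //.
by have [lT _ _] := hT; rewrite Oval_linear op_twist_linear.
Qed.

Fact diffopD n (U : set (C * C)) S T : diffop n U S -> diffop n U T ->
  diffop n U (S \+ T).
Proof.
move=> [lS [j oS] hS] [lT [k oT] hT]; split.
- by move=> c f g; rewrite /= lS lT scalerDr addrACA.
- by exists (maxn j k); apply: op_order_ltD; [apply: op_order_ltW oS | apply: op_order_ltW oT];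
    rewrite ?leq_maxl ?leq_maxr.
- by move=> W hW f hf; apply: OsecD; [apply: hS | apply: hT].
Qed.

Fact diffopZ n (U : set (C * C)) (c : C) T : diffop n U T -> diffop n U (c \*: T).
Proof.
move=> [lT [k oT] hT]; split.
- by move=> a f g; rewrite /= lT scalerDr !scalerA mulrC.
- by exists k; apply: op_order_ltZ.
- by move=> W hW f hf; apply: OsecZ; apply: hT.
Qed.

Fact diffopM n (U : set (C * C)) S T : diffop n U S -> diffop n U T ->
  diffop n U (S \o T).
Proof.
move=> [lS [j oS] hS] [lT [k oT] hT]; split.
- by move=> c f g; rewrite /= lT lS.
- by exists (j + k)%N; apply: op_order_lt_comp.
- by move=> W hW f hf; apply: hS => //; apply: hT.
Qed.

Fact diffop1 n (U : set (C * C)) : diffop n U id.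
Proof.
split=> //; exists 1%N.
have -> : (id : F -> F) = *%R 1 by apply/funext => h; rewrite mul1r.
exact: op_order_lt_mul.
Qed.

Fact tO_actD (U : zopen_in Uoo) S T s : diffop 0 U S -> diffop 0 U T ->
  @tO_act U (S \+ T) s = @tO_act U S s + @tO_act U T s.
Proof.
move=> hS hT; apply: val_inj; rewrite raddfD /= !tO_actE //; last exact: diffopD.
by have [_ oS _] := hS; have [_ oT _] := hT; rewrite op_twistD.
Qed.

Fact tO_actZ (U : zopen_in Uoo) (c : C) T s : diffop 0 U T ->
  @tO_act U (c \*: T) s = c *: @tO_act U T s.
Proof.
move=> hT; apply: val_inj; rewrite linearZ /= !tO_actE //; last exact: diffopZ.
by have [_ oT _] := hT; rewrite op_twistZ.
Qed.

Fact tO_act1 (U : zopen_in Uoo) s : @tO_act U id s = s.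
Proof. by apply: val_inj; rewrite /= tO_actE ?op_twist_id //; apply: diffop1. Qed.

Fact tO_actM (U : zopen_in Uoo) S T s : diffop 0 U S -> diffop 0 U T ->
  @tO_act U (S \o T) s = @tO_act U S (@tO_act U T s).
Proof.
move=> hS hT; apply: val_inj; rewrite /= !tO_actE //; last exact: diffopM.
by have [lS oS _] := hS; have [lT oT _] := hT; rewrite op_twist_comp.
Qed.

Fact tO_act_res (U V : zopen_in Uoo) (h : V `<=` U) T s : diffop 0 U T ->
  @tO_res U V h (@tO_act U T s) = @tO_act V T (@tO_res U V h s).
Proof.
move=> hT; have hT' := diffop_sub h hT.
by apply: val_inj; rewrite /= OresE !tO_actE //= OresE.
Qed.

(* The structure sheaf of U_infty with T in D(U) acting as T twisted by eta; on
   global sections w acts by multiplication and d/dw by d/dw - eta. *)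
Definition twisted_O : dmodule 0 Uoo :=
  @DModule 0 Uoo tO_sec tO_res tO_act tO_res_id tO_res_comp tO_glue tO_act_linear
    tO_actD tO_actZ tO_act1 tO_actM tO_act_res.

End TwistedO.

(* Under the trivialization f |-> f(w,1), O(n)(W) = O(W) for W contained in
   U_infty, so that D_n and D_X have the same sections there (diffop_twist). *)
Section DirectImage.
Variables (n : int) (M : dmodule 0 Uoo).

Fact trace_sub (U : zopen C) : zopenI U Uoo `<=` Uoo.
Proof. by move=> x []. Qed.
Definition trace (U : zopen C) : zopen_in Uoo := ZOpenIn (@trace_sub U).

Fact trace_res (U V : zopen_in X) : V `<=` U -> trace V `<=` trace U.
Proof. by move=> h x [/h]. Qed.

Definition di_sec (U : zopen_in X) : lmodType C := dsec M (trace U).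
Definition di_res (U V : zopen_in X) (h : V `<=` U) : {linear di_sec U -> di_sec V} :=
  dres M (trace_res h).
Definition di_act (U : zopen_in X) (T : F -> F) : di_sec U -> di_sec U :=
  dact (U := trace U) T.

Fact di_diffop (U : zopen_in X) T : diffop n U T -> diffop 0 (trace U) T.
Proof.
move=> hT; apply: (@diffop_twist _ n 0 (trace U)); first exact: trace_sub.
by apply: diffop_sub hT => x [].
Qed.

Fact di_glue (U : zopen_in X) (I : Type) (V : I -> zopen_in X)
    (hV : forall i, V i `<=` U) (s : forall i, di_sec (V i)) :
  U `<=` \bigcup_i (V i : set _) ->
  (forall i j (W : zopen_in X) (hi : W `<=` V i) (hj : W `<=` V j),
    di_res hi (s i) = di_res hj (s j)) ->
  exists! r : di_sec U, forall i, di_res (hV i) r = s i.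
Proof.
move=> hU hs; apply: (dglue (d := M) (V := fun i => trace (V i))).
  by move=> x [/hU [i _ hx] hx']; exists i.
move=> i j W hi hj.
have hWX : W `<=` X by move=> x /hi [hx _]; apply: zopen_in_sub hx.
pose W' : zopen_in X := ZOpenIn hWX.
have hi' : W' `<=` V i by move=> x /hi [].
have hj' : W' `<=` V j by move=> x /hj [].
have hW : W `<=` trace W' by move=> x hx; split=> //; apply: zopen_in_sub hx.
have := congr1 (dres M hW) (hs i j W' hi' hj').
by rewrite (dres_comp _ _ hi) (dres_comp _ _ hj).
Qed.

Definition direct_image : dmodule n X.
refine (@DModule n X di_sec di_res di_act _ _ di_glue _ _ _ _ _ _).
- by move=> U h s; apply: dres_id.
- by move=> U V W hVU hWV hWU s; apply: dres_comp.
- by move=> U T /di_diffop hT; apply: dact_linear.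
- by move=> U S T s /di_diffop hS /di_diffop hT; apply: dactD.
- by move=> U c T s /di_diffop hT; apply: dactZ.
- by move=> U s; apply: dact1.
- by move=> U S T s /di_diffop hS /di_diffop hT; apply: dactM.
- by move=> U V h T s /di_diffop hT; apply: dact_res.
Defined.

End DirectImage.

Section GlobalSections.
Variable n : int.
Local Notation w := (rat_w C).
Implicit Types (f : F) (x y : sl2 C).

(* The operators by which E, F, H act on sections of O(n) when the action
   (g . h)(v) = h(g^-1 v) on homogeneous functions is differentiated, in the
   trivialization h |-> h(w,1).  They belong to D_n(X) by diffop_op_sl2. *)
Definition op_E f := - rat_deriv f.
Definition op_F f := w ^+ 2 * rat_deriv f - n%:~R * w * f.
Definition op_H f := - 2 * w * rat_deriv f + n%:~R * f.

(* x = x_00 H + x_01 E + x_10 F *)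
Definition op_sl2 x f := x 0 0 *: op_H f + x 0 1 *: op_E f + x 1 0 *: op_F f.

Local Notation dw := (@rat_deriv C).

Lemma rat_derivD f g : dw (f + g) = dw f + dw g. Proof. exact: raddfD. Qed.
Lemma rat_derivN f : dw (- f) = - dw f. Proof. exact: raddfN. Qed.
Lemma rat_deriv_const (c : C) : dw (rat_poly c%:P) = 0.
Proof. by rewrite rat_deriv_poly derivC rmorph0. Qed.
Lemma rat_deriv1 : dw 1 = 0.
Proof. by have := rat_deriv_const 1; rewrite rmorph1. Qed.
Lemma rat_deriv_nat (k : nat) : dw k%:R = 0.
Proof. by elim: k => [|k IH]; rewrite ?raddf0 // -natr1 rat_derivD IH rat_deriv1 addr0. Qed.
Lemma rat_deriv_int (k : int) : dw k%:~R = 0.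
Proof.
by case: k => k; rewrite ?NegzE ?mulrNz ?rat_derivN -?pmulrn ?rat_deriv_nat ?oppr0.
Qed.

Lemma op_sl2_bracket x y f :
  op_sl2 (sl2_bracket x y) f = op_sl2 x (op_sl2 y f) - op_sl2 y (op_sl2 x f).
Proof.
have tr (z : sl2 C) : z 1 1 = - z 0 0.
  case: z => z /=; rewrite unfold_in /mxtrace !big_ord_recr big_ord0 /= add0r.
  rewrite (_ : widen_ord _ _ = 0); last exact: val_inj.
  rewrite (_ : ord_max = 1); last exact: val_inj.
  by rewrite addrC addr_eq0 => /eqP.
have mul2 (A B : 'M[C]_2) i j : (A *m B) i j = A i 0 * B 0 j + A i 1 * B 1 j.
  rewrite mxE !big_ord_recr big_ord0 /= add0r.
  rewrite (_ : widen_ord _ _ = 0); last exact: val_inj.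
  by rewrite (_ : ord_max = 1); last exact: val_inj.
have sub2 (A B : 'M[C]_2) i j : (A - B) i j = A i j - B i j by rewrite !mxE.
pose c (a : C) : F := rat_poly a%:P.
have opE (z : sl2 C) h : op_sl2 z h = c (z 0 0) * (- 2 * w * dw h + n%:~R * h)
    + c (z 0 1) * (- dw h) + c (z 1 0) * (w ^+ 2 * dw h - n%:~R * w * h) by [].
have dop (z : sl2 C) h : dw (op_sl2 z h) =
    c (z 0 0) * (- 2 * dw h - 2 * w * dw (dw h) + n%:~R * dw h) - c (z 0 1) * dw (dw h)
    + c (z 1 0) * (2 * w * dw h + w ^+ 2 * dw (dw h) - n%:~R * h - n%:~R * w * dw h).
  have d0 := rat_deriv_const; have dn := rat_deriv_int n; have d1 := rat_deriv_w C.
  have d2 : dw (- 2) = 0 by rewrite rat_derivN (rat_deriv_nat 2) oppr0.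
  rewrite opE (rat_derivD _ (c (z 1 0) * _)) rat_derivD 3!(rat_derivM (c _)) !d0.
  rewrite !mul0r !add0r rat_derivN rat_derivD (rat_derivM _ h) dn.
  rewrite (rat_derivM _ (dw h)) (rat_derivM _ w) d2 d1.
  rewrite rat_derivD rat_derivN (rat_derivM _ (dw h)) expr2 (rat_derivM w w) d1.
  rewrite (rat_derivM _ h) (rat_derivM _ w) dn d1.
  move: (n%:~R) (c (z 0 0)) (c (z 0 1)) (c (z 1 0)) (dw (dw h)) (dw h) w => *; ring.
rewrite (opE x) (opE y (op_sl2 x f)) !dop !opE.
have -> : sl2_bracket x y 0 0 = x 0 1 * y 1 0 - y 0 1 * x 1 0.
  by rewrite sub2 !mul2; ring.
have -> : sl2_bracket x y 0 1 = 2 * (x 0 0 * y 0 1 - y 0 0 * x 0 1).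
  by rewrite sub2 !mul2 !tr; ring.
have -> : sl2_bracket x y 1 0 = 2 * (y 0 0 * x 1 0 - x 0 0 * y 1 0).
  by rewrite sub2 !mul2 !tr; ring.
have cD a b : c (a - b) = c a - c b by rewrite /c polyCB rmorphB.
have cM a b : c (a * b) = c a * c b by rewrite /c polyCM rmorphM.
have c2 : c 2 = 2 by rewrite /c polyC_natr rmorph_nat.
rewrite !(cM 2) !cD !cM c2.
move: (n%:~R) (c (x 0 0)) (c (x 0 1)) (c (x 1 0)) (c (y 0 0)) (c (y 0 1)) (c (y 1 0)).
move: (dw (dw f)) (dw f) w => *; ring.
Qed.

Lemma op_sl2_linear x : linear (op_sl2 x).
Proof.
move=> c f g; rewrite /op_sl2 /op_E /op_F /op_H !rat_scaleE.
rewrite !(rat_derivD, rat_derivM, rat_deriv_const).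
ring.
Qed.

Lemma op_sl2_linear_l f : linear (op_sl2^~ f).
Proof.
move=> c x y /=; rewrite /op_sl2 !mxE !rat_scaleE !(rmorphD, rmorphM) /=.
ring.
Qed.

Lemma op_sl2_order x : op_order_lt 2 (op_sl2 x).
Proof.
move=> f g h; rewrite /opcomm /op_sl2 /op_E /op_F /op_H !rat_scaleE !rat_derivM.
ring.
Qed.

Lemma regular_at_sq d e (p q : {poly C}) (x : C * C) : (size p <= (d + e).+1)%N ->
  (size q <= e.+1)%N -> d%:Z = e%:Z + n -> bform e q x != 0 ->
  regular_at n x (rat_poly p / rat_poly (q ^+ 2)).
Proof.
move=> hp hq hd h; exists (d + e)%N, (e + e)%N, p, (q ^+ 2); split=> //.
- by split=> //; rewrite expr2; have := size_polyMleq q q; lia.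
- by lia.
- by rewrite expr2 bformM // mulf_neq0.
Qed.

Lemma size_deriv_le d (p : {poly C}) : (size p <= d.+1)%N -> (size p^`() <= d)%N.
Proof.
move=> /leq_sizeP hp; apply/leq_sizeP => j hj.
by rewrite coef_deriv hp ?mul0rn.
Qed.

Lemma size_euler d (p : {poly C}) : (size p <= d.+1)%N ->
  (size ('X * p^`() - d%:R *: p)%R <= d)%N.
Proof.
move=> /leq_sizeP hp; apply/leq_sizeP => j hj.
rewrite coefB coefXM coefZ coef_deriv; case: j hj => [|j] hj.
  by move: hj; rewrite leqn0 => /eqP ->; rewrite mul0r subr0.
have [e|ne] := eqVneq d j.+1; first by rewrite e /= mulr_natl subrr.
by rewrite /= hp ?mul0rn ?mulr0 ?subr0 // ltn_neqAle ne.
Qed.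

Lemma Osec_op_sl2 x (W : set (C * C)) f : Osec n W f -> Osec n W (op_sl2 x f).
Proof.
move=> hf; have h (pt : C * C) (hpt : W pt) := hf pt hpt.
have key (pt : C * C) : W pt ->
   [/\ regular_at n pt (op_E f), regular_at n pt (op_F f) & regular_at n pt (op_H f)].
  move=> /hf [d [e [p [q [[hp hq] hd q0 ->]]]]].
  have nzq := bform_neq0 q0.
  have nzQ : rat_poly q != 0 by rewrite rat_poly_eq0.
  have hp' := size_deriv_le hp; have hq' := size_deriv_le hq.
  have hsum (a b : {poly C}) k : (size a <= k)%N -> (size b <= k)%N -> (size (a + b)%R <= k)%N.
    by move=> ha hb; apply: leq_trans (size_polyD _ _) _; rewrite geq_max ha hb.
  have hmul (a b : {poly C}) i j k : (size a <= i)%N -> (size b <= j)%N ->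
      (i + j <= k.+1)%N -> (size (a * b)%R <= k)%N.
    by move=> ha hb hk; apply: leq_trans (size_polyMleq _ _) _; lia.
  have h1 : (size (p^`() * q - p * q^`())%R <= d + e)%N.
    apply: hsum; first by apply: (hmul _ _ _ _ _ hp' hq); lia.
    by rewrite size_polyN; apply: (hmul _ _ _ _ _ hp hq'); lia.
  have comb (a b A : {poly C}) : rat_poly a * (rat_poly A / rat_poly (q ^+ 2)) +
      rat_poly b * (rat_poly p / rat_poly q) =
      rat_poly (a * A + b * p * q) / rat_poly (q ^+ 2).
    rewrite !mulrA -!rmorphM addf_div ?rat_poly_eq0 ?expf_neq0 // -!rmorphM -rmorphD.
    apply/eqP; rewrite rat_frac_eq ?mulf_neq0 ?expf_neq0 //; apply/eqP.
    by rewrite expr2; ring.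
  have nE : (n%:~R : {poly C}) = d%:R - e%:R.
    have -> : n = d%:Z - e%:Z by lia.
    by rewrite rmorphB /= -!pmulrn.
  have nE' : (n%:~R : F) = rat_poly (d%:R - e%:R) by rewrite -nE rmorph_int.
  split.
  - have -> : op_E (rat_poly p / rat_poly q) =
        rat_poly (- (p^`() * q - p * q^`())) / rat_poly (q ^+ 2).
      by rewrite /op_E rat_derivE // rmorphN mulNr.
    by apply: (regular_at_sq (d := d) (e := e)) => //; rewrite size_polyN leqW.
  - have -> : op_F (rat_poly p / rat_poly q) =
        rat_poly ('X * (('X * p^`() - d%:R *: p) * q - p * ('X * q^`() - e%:R *: q)))
          / rat_poly (q ^+ 2).
      rewrite /op_F rat_derivE // nE' /rat_w -!mul_polyC !polyC_natr.
      rewrite -mulNr -rmorphXn -rmorphM -rmorphN comb.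
      by congr (rat_poly _ / _); ring.
    apply: (regular_at_sq (d := d) (e := e)) => //.
    have hh : (size (('X * p^`() - d%:R *: p) * q - p * ('X * q^`() - e%:R *: q))%R <= d + e)%N.
      have hdp := size_euler hp; have heq := size_euler hq.
      apply: hsum; first by apply: (hmul _ _ _ _ _ hdp hq); lia.
      by rewrite size_polyN; apply: (hmul _ _ _ _ _ hp heq); lia.
    by apply: (hmul _ _ 2 _ _ _ hh); rewrite ?size_polyX //; lia.
  - have -> : op_H (rat_poly p / rat_poly q) =
        rat_poly (- 2 * 'X * (p^`() * q - p * q^`()) + (d%:R - e%:R) * (p * q))
          / rat_poly (q ^+ 2).
      rewrite /op_H rat_derivE // nE' /rat_w.
      have -> : (- 2 : F) = rat_poly (- 2) by rewrite rmorphN rmorph_nat.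
      by rewrite -rmorphM comb mulrA.
    apply: (regular_at_sq (d := d) (e := e)) => //.
    have h2 : (size (p * q)%R <= (d + e).+1)%N by apply: (hmul _ _ _ _ _ hp hq); lia.
    rewrite -!polyC_natr -polyCB -polyCN !mul_polyC -scalerAl.
    apply: hsum; last exact: leq_trans (size_scale_leq _ _) h2.
    apply: leq_trans (size_scale_leq _ _) _.
    by apply: (hmul _ _ 2 _ _ _ h1); rewrite ?size_polyX //; lia.
move=> pt /key [hE hF hH]; rewrite /op_sl2.
by apply: regular_atD; [apply: regular_atD|]; apply: regular_atZ.
Qed.

Lemma diffop_op_sl2 x U : diffop n U (op_sl2 x).
Proof.
split; [exact: op_sl2_linear | by exists 2%N; apply: op_sl2_order |].
by move=> W _ f; apply: Osec_op_sl2.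
Qed.

Definition topX : zopen_in X := @ZOpenIn X X (@subset_refl _ X).

Definition global_sections (M : dmodule n X) : sl2_module C.
refine (@Sl2Module C (dsec M topX) (fun x s => dact (U := topX) (op_sl2 x) s) _ _ _).
- by move=> x; apply/dact_linear/diffop_op_sl2.
- move=> s c x y /=.
  have -> : op_sl2 (c *: x + y) = (c \*: op_sl2 x) \+ op_sl2 y.
    by apply/funext => f; rewrite op_sl2_linear_l.
  have hx := diffop_op_sl2 x topX; have hy := diffop_op_sl2 y topX.
  by rewrite dactD ?dactZ //; apply: diffopZ.
- move=> x y s /=.
  have hx := diffop_op_sl2 x topX; have hy := diffop_op_sl2 y topX.
  have hxy := diffopM hx hy; have hyx := diffopM hy hx.
  have -> : op_sl2 (sl2_bracket x y) =
      (op_sl2 x \o op_sl2 y) \+ ((-1) \*: (op_sl2 y \o op_sl2 x)).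
    by apply/funext => f; rewrite op_sl2_bracket /= scaleN1r.
  rewrite dactD //; last exact: diffopZ.
  by rewrite dactZ // !dactM // scaleN1r.
Defined.

End GlobalSections.
End DModules.

(* Main.v *)
Require Import Defs.
From HB Require Import structures.
From mathcomp Require Import all_boot all_order all_algebra.
From mathcomp Require Import boolp classical_sets functions reals complex.
From mathcomp Require Import ring zify.
Import Order.TTheory GRing.Theory Num.Theory.
Local Open Scope ring_scope.

(* Put n = t - 1.  Functions regular on the affine line U_infty are polynomials,
   so the global sections are C[w] with d/dw replaced by D = d/dw - eta:
     E = - D,  H = n - 2 w D,  F = w^2 D - n w.
   As eta - E = d/dw, every nonzero submodule contains 1; as eta is nonzero,
   H w^k = (n - 2k) w^k + 2 eta w^(k+1) shows that 1 generates under H alone.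
   Central elements preserve the constants, which are the Whittaker vectors, and
   so act by scalars.  Conversely, a Whittaker vector v on which the Casimir
   element acts by n^2 + 2n determines a linear map from C[w] sending 1 to v and
   commuting with H; it commutes with E and F at 1, hence everywhere because
   both are eigenvectors of ad H. *)

(** * Structure constants of sl2 and centrality of the Casimir element *)

Section Sl2Relations.
Context {C : numClosedFieldType}.
Local Notation H := (sl2_H C).
Local Notation E := (sl2_E C).
Local Notation F := (sl2_F C).

(** The trace condition recovers the entry at [1 1]. *)
Lemma sl2_eqP (x y : sl2 C) :
  x 0 0 = y 0 0 -> x 0 1 = y 0 1 -> x 1 0 = y 1 0 -> x = y.
Proof.
have tr (z : sl2 C) : z 1 1 = - z 0 0.
  case: z => z /=; rewrite unfold_in /mxtrace big_ord_recl big_ord1.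
  rewrite (_ : lift _ _ = 1); last exact: val_inj.
  by rewrite addrC addr_eq0 => /eqP.
move=> e00 e01 e10; apply/val_inj/matrixP => i j.
have ord2 (k : 'I_2) : k = 0 \/ k = 1.
  by case: k => [[|[|//]] hk]; [left | right]; apply: val_inj.
have [->|->] := ord2 i; have [->|->] := ord2 j => //.
by rewrite /= !tr e00.
Qed.

Lemma sl2_decomp (x : sl2 C) : x = x 0 0 *: H + (x 0 1 *: E + x 1 0 *: F).
Proof. by apply: sl2_eqP; rewrite !mxE /=; ring. Qed.

Lemma sl2_bracketE (x y : sl2 C) i j : sl2_bracket x y i j =
  x i 0 * y 0 j + x i 1 * y 1 j - (y i 0 * x 0 j + y i 1 * x 1 j).
Proof.
have mul2 (A B : 'M[C]_2) : (A *m B) i j = A i 0 * B 0 j + A i 1 * B 1 j.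
  rewrite mxE big_ord_recl big_ord1.
  by rewrite (_ : lift _ _ = 1); last exact: val_inj.
have sub2 (A B : 'M[C]_2) : (A - B) i j = A i j - B i j by rewrite !mxE.
by rewrite sub2 !mul2.
Qed.

Lemma sl2_bracket_HE : sl2_bracket H E = 2 *: E.
Proof. by apply: sl2_eqP; rewrite sl2_bracketE !mxE /=; ring. Qed.

Lemma sl2_bracket_HF : sl2_bracket H F = (- 2) *: F.
Proof. by apply: sl2_eqP; rewrite sl2_bracketE !mxE /=; ring. Qed.

Lemma sl2_bracket_EF : sl2_bracket E F = H.
Proof. by apply: sl2_eqP; rewrite sl2_bracketE !mxE /=; ring. Qed.

(** The centralizer of [z] contains the scalars and is closed under sums and products, so induction
    over expressions leaves only the generators. *)
Lemma ucentral_gen (z : Usl2 C) :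
  (forall x, z * uinj x = uinj x * z) -> ucentral z.
Proof.
move=> hz; elim/usl2_ind; elim=> [c|x|u IHu v IHv|u IHu v IHv].
- have -> : umk (UScal c) = c *: 1 :> Usl2 C.
    rewrite -[RHS]/(uscale c (umk _)) uscaleE; apply/umkP.
    by have := ueq_scalM c 1; rewrite mulr1.
  by rewrite -scalerAl -scalerAr mul1r mulr1.
- exact: hz.
- have -> : umk (UAdd u v) = umk u + umk v by rewrite -uaddE.
  by rewrite mulrDl mulrDr IHu IHv.
- have -> : umk (UMul u v) = umk u * umk v by rewrite -umulE.
  by rewrite mulrA IHu -mulrA IHv mulrA.
Qed.

(** Each [br a] is a derivation, so its value on the Casimir element follows from the structure
    constants; it vanishes for [a] equal to [e], [f] and [h]. *)
Lemma casimir_central : ucentral (casimir C).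
Proof.
pose br (a b : Usl2 C) := a * b - b * a.
have brM a b c : br a (b * c) = br a b * c + b * br a c.
  by rewrite /br mulrBl mulrBr !mulrA addrA subrK.
have brD a b c : br a (b + c) = br a b + br a c.
  by rewrite /br mulrDl mulrDr opprD addrACA.
have brZ a (k : C) b : br a (k *: b) = k *: br a b.
  by rewrite /br -scalerAl -scalerAr scalerBr.
have brC a b : br a b = - br b a by rewrite opprB.
set e := uinj E; set f := uinj F; set h := uinj H.
have uinjZ (k : C) x : uinj (k *: x) = k *: uinj x.
  have uinj0 : uinj (0 : sl2 C) = 0.
    by have := uinj_linear (-1) (0 : sl2 C) 0; rewrite scaler0 addr0 scaleN1r addNr.
  by have := uinj_linear k x 0; rewrite uinj0 !addr0.
have hhe : br h e = 2 *: e by rewrite /br -uinj_bracket sl2_bracket_HE uinjZ.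
have hhf : br h f = (- 2) *: f by rewrite /br -uinj_bracket sl2_bracket_HF uinjZ.
have hef : br e f = h by rewrite /br -uinj_bracket sl2_bracket_EF.
have br0 a : br a a = 0 by rewrite /br subrr.
have cE : br e (casimir C) = 0.
  rewrite /casimir -/e -/f -/h expr2 !brD !brZ !brM hef (brC e h) hhe br0.
  rewrite !mulNr !mulrN !mul0r !mulr0 add0r addr0 -scalerAl -scalerAr -!scaleNr.
  by rewrite -addrA -!scalerDr -scalerDl addNr scale0r.
have cF : br f (casimir C) = 0.
  rewrite /casimir -/e -/f -/h expr2 !brD !brZ !brM (brC f h) (brC f e) hhf hef br0.
  rewrite !scaleNr opprK !mulNr !mulrN !mul0r !mulr0 add0r addr0.
  rewrite -scalerAl -scalerAr -addrA -!scalerDr.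
  by rewrite [h * f + _]addrC scaleN1r subrr scaler0.
have cH : br h (casimir C) = 0.
  rewrite /casimir -/e -/f -/h expr2 !brD !brZ !brM hhf hhe br0.
  rewrite mul0r mulr0 !addr0 add0r -!scalerAl -!scalerAr !scaleNr.
  by rewrite subrr addNr scaler0 addr0.
apply: ucentral_gen => x; apply/esym/eqP; rewrite -subr_eq0 -/(br _ _); apply/eqP.
rewrite {1}[x]sl2_decomp !uinj_linear uinjZ brC !brD !brZ.
by rewrite (brC _ h) (brC _ e) (brC _ f) cH cE cF !oppr0 !scaler0 !addr0 oppr0.
Qed.

End Sl2Relations.

(** * The twisted operators on polynomials and their irreducibility *)

Section PolynomialModel.
Context {C : numClosedFieldType}.
Variables (n : int) (eta : C).
Implicit Types (p q : {poly C}) (x y : sl2 C) (M Y : sl2_module C).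
Local Notation H := (sl2_H C).
Local Notation E := (sl2_E C).
Local Notation F := (sl2_F C).

Definition whit_E p := eta *: p - p^`().
Definition whit_F p := 'X ^+ 2 * (p^`() - eta *: p) - n%:~R *: ('X * p).
Definition whit_H p := n%:~R *: p - 2 *: ('X * (p^`() - eta *: p)).
Definition whit_op x p := x 0 0 *: whit_H p + (x 0 1 *: whit_E p + x 1 0 *: whit_F p).

Lemma whit_E_linear : linear whit_E.
Proof.
move=> c p q; rewrite /whit_E derivD derivZ -!mul_polyC; ring.
Qed.
Lemma whit_F_linear : linear whit_F.
Proof.
move=> c p q; rewrite /whit_F derivD derivZ -!mul_polyC; ring.
Qed.
Lemma whit_H_linear : linear whit_H.
Proof.
move=> c p q; rewrite /whit_H derivD derivZ -!mul_polyC; ring.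
Qed.

Lemma whit_op_H p : whit_op H p = whit_H p.
Proof. by rewrite /whit_op !mxE /= subr0 scale1r subr0 !scale0r !addr0. Qed.
Lemma whit_op_E p : whit_op E p = whit_E p.
Proof. by rewrite /whit_op !mxE /= scale1r !scale0r add0r addr0. Qed.
Lemma whit_op_F p : whit_op F p = whit_F p.
Proof. by rewrite /whit_op !mxE /= scale1r !scale0r !add0r. Qed.

Lemma whit_HE p : whit_H (whit_E p) - whit_E (whit_H p) = 2 *: whit_E p.
Proof.
rewrite /whit_H /whit_E !(derivB, derivD, derivZ, derivM, derivX) -!mul_polyC.
rewrite polyC_natr; ring.
Qed.

Lemma whit_HF p : whit_H (whit_F p) - whit_F (whit_H p) = (- 2) *: whit_F p.
Proof.
rewrite /whit_H /whit_F expr2 !(derivB, derivD, derivZ, derivM, derivX) -!mul_polyC.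
rewrite polyCN polyC_natr; ring.
Qed.

Lemma whit_casimir p :
  whit_H (whit_H p) + 2 *: whit_E (whit_F p) + 2 *: whit_F (whit_E p) =
  (n ^+ 2 + 2 * n)%:~R *: p.
Proof.
rewrite /whit_H /whit_F /whit_E expr2 !(derivB, derivD, derivZ, derivM, derivX).
rewrite -!mul_polyC; ring.
Qed.

(** Since [E 1 = eta] and [E F = F E + H], the Casimir identity at [1] becomes a formula for [F 1]
    in terms of [H]. *)
Lemma whit_casimir1 :
  (n ^+ 2 + 2 * n)%:~R *: (1 : {poly C}) - whit_H (whit_H 1) - 2 *: whit_H 1 =
  (4 * eta) *: whit_F 1.
Proof.
rewrite /whit_H /whit_F !(derivB, derivD, derivZ, derivM, derivX, derivC).
rewrite -!mul_polyC; ring.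
Qed.

Hypothesis eta_neq0 : eta != 0.

Lemma whit_HXk k : whit_H 'X^k = (n%:~R - 2 * k%:R) *: 'X^k + (2 * eta) *: 'X^(k.+1).
Proof.
rewrite /whit_H derivXn -!mul_polyC exprS; case: k => [|k].
  by rewrite mulr0n expr0; ring.
by rewrite /= exprS -mulr_natl; ring.
Qed.

Lemma poly_span (K : set {poly C}) :
  (forall (c : C) p q, K p -> K q -> K (c *: p + q)) -> (forall k, K 'X^k) ->
  forall p, K p.
Proof.
move=> Klin KX.
have K0 : K 0 by rewrite -(addNr 'X^0) -scaleN1r; apply: Klin.
have KZ (c : C) p : K p -> K (c *: p) by move=> hp; rewrite -[_ *: _]addr0; apply: Klin.
move=> p; rewrite -[p]coefK poly_def.
by elim/big_ind: _ => // [q r hq hr|i _]; [rewrite -[q]scale1r; apply: Klin | apply/KZ/KX].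
Qed.

Lemma whit_span (K : set {poly C}) :
  (forall (c : C) p q, K p -> K q -> K (c *: p + q)) ->
  (forall p, K p -> K (whit_H p)) -> K 1 -> forall p, K p.
Proof.
move=> Klin KH K1; apply: poly_span => // k.
elim: k => [|k IH]; first by rewrite expr0.
(* [whit_HXk] solved for its term of degree [k + 1], as [2 * eta] is invertible; the zero
   ['X^k - 'X^k] is the second summand that [Klin] expects. *)
have -> : 'X^(k.+1) =
    (2 * eta)^-1 *: ((2 * k%:R - n%:~R) *: 'X^k + whit_H 'X^k) + ('X^k - 'X^k) :> {poly C}.
  rewrite subrr addr0 whit_HXk addrA -scalerDl addrA subrK subrr scale0r add0r scalerA.
  by rewrite mulVf ?scale1r // mulf_neq0 // pnatr_eq0.
apply: (Klin _ _ _ (Klin _ _ _ IH (KH _ IH))).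
by rewrite addrC -scaleN1r; apply: Klin.
Qed.

(** Differentiation, which is [eta - E], lowers the degree of a nonzero element of [K] until a
    nonzero constant is reached; [whit_span] then gives everything. *)
Lemma whit_irreducible (K : set {poly C}) :
  (forall (c : C) p q, K p -> K q -> K (c *: p + q)) ->
  (forall p, K p -> K (whit_E p)) -> (forall p, K p -> K (whit_H p)) ->
  forall p, K p -> p != 0 -> forall q, K q.
Proof.
move=> Klin KE KH p Kp p0; apply: whit_span => //.
have K0 : K 0 by have := Klin (- 1) p p Kp Kp; rewrite scaleN1r addNr.
move: {2}(size p) (leqnn (size p)) => m.
elim: m p Kp p0 => [|m IH] p Kp p0; first by rewrite leqn0 size_poly_eq0 (negbTE p0).
move=> hm; have [hs|hs] := leqP (size p) 1.
  have hp := size1_polyC hs; have c0 : p`_0 != 0.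
    by apply: contraNneq p0 => c0; rewrite hp c0.
  have -> : 1 = (p`_0)^-1 *: p + 0.
    by rewrite addr0 {2}hp -mul_polyC -polyCM mulVf.
  exact: Klin.
have hd : p^`() = (- 1) *: whit_E p + (eta *: p + 0).
  by rewrite /whit_E scaleN1r addr0 opprB subrK.
apply: (IH p^`()).
- by rewrite hd; apply/Klin/Klin => //; apply: KE.
(* In characteristic zero a vanishing derivative kills every coefficient of positive index, which
   the size of [p] excludes. *)
- apply: contraTneq hs => dp0; rewrite -leqNgt; apply/leq_sizeP => -[|j] // _.
  apply/eqP; have := congr1 (fun q : {poly C} => q`_j) dp0.
  rewrite coef_deriv coef0 => /eqP; rewrite -mulr_natr mulf_eq0 pnatr_eq0 /= orbF //.
- by rewrite -ltnS; apply: leq_trans (lt_size_deriv p0) hm.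
Qed.

(** The bracket identity for [whit_op] comes with [M], so the polynomials themselves are not made
    into an [sl2_module]. *)
Definition whit_model M := exists2 e : {linear {poly C} -> M},
  bijective e & forall x p, e (whit_op x p) = sl2_act x (e p).

Lemma whit_model_unique M Y : whit_model M -> whit_model Y -> sl2_isomorphic M Y.
Proof.
move=> [e [g eK gK] he] [e' be' he'].
have glin : linear g by move=> c u v; apply: (can_inj eK); rewrite linearP !gK.
have philin : linear (e' \o g) by move=> c u v; rewrite /= glin linearP.
pose phi : {linear M -> Y} :=
  HB.pack (e' \o g) (GRing.isLinear.Build C M Y *:%R (e' \o g) philin).
exists phi; split; first by apply: bij_comp => //; exists e.
move=> x v /=; rewrite -he'; congr (e' _).
by apply: (can_inj eK); rewrite gK he gK.
Qed.

End PolynomialModel.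

(** * Irreducible Whittaker modules and the polynomial model *)

Section WhittakerModules.
Context {C : numClosedFieldType}.
Variables (n : int) (eta : C).
Hypothesis eta_neq0 : eta != 0.
Implicit Types (p q : {poly C}) (x y : sl2 C) (M Y : sl2_module C).
Local Notation H := (sl2_H C).
Local Notation E := (sl2_E C).
Local Notation F := (sl2_F C).
Local Notation c0 := ((n ^+ 2 + 2 * n)%:~R : C).

Lemma sl2_act0 M x : sl2_act x (0 : M) = 0.
Proof. by have := sl2_act_linear x (- 1) (0 : M) 0; rewrite scaler0 addr0 scaleN1r addNr. Qed.
Lemma sl2_actZ M x (c : C) (v : M) : sl2_act x (c *: v) = c *: sl2_act x v.
Proof. by have := sl2_act_linear x c v 0; rewrite sl2_act0 !addr0. Qed.
Lemma sl2_act_0l M (v : M) : sl2_act 0 v = 0.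
Proof. by have := sl2_act_linear_l v (- 1) 0 0; rewrite /= scaler0 addr0 scaleN1r addNr. Qed.
Lemma sl2_act_Zl M (c : C) x (v : M) : sl2_act (c *: x) v = c *: sl2_act x v.
Proof. by have := sl2_act_linear_l v c x 0; rewrite /= sl2_act_0l !addr0. Qed.

Lemma casimir_act M (v : M) : usl2_act (casimir C) v =
  sl2_act H (sl2_act H v) + 2 *: sl2_act E (sl2_act F v) + 2 *: sl2_act F (sl2_act E v).
Proof. by rewrite /casimir expr2 !(usl2_actD, usl2_actZ, usl2_actM, usl2_act_gen). Qed.

(** * The map from polynomials determined by a Whittaker vector *)

Section Universal.
Variables (Y : sl2_module C) (v : Y).
Hypothesis Ev : whittaker_vector eta v.
Hypothesis casv : usl2_act (casimir C) v = c0 *: v.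

(** The image of ['X^k] forced by [1 |-> v] and compatibility with [H]: the recursion of
    [whit_HXk]. *)
Fixpoint whit_seq (k : nat) : Y :=
  if k is k'.+1 then
    (2 * eta)^-1 *: ((2 * k'%:R - n%:~R) *: whit_seq k' + sl2_act H (whit_seq k'))
  else v.

Definition whit_map p : Y := \sum_(i < size p) p`_i *: whit_seq i.

Lemma whit_map_wide m p : (size p <= m)%N -> whit_map p = \sum_(i < m) p`_i *: whit_seq i.
Proof.
move=> hm; rewrite /whit_map (big_ord_widen _ (fun i => p`_i *: whit_seq i) hm) big_mkcond.
by apply: eq_bigr => i _; case: ltnP => // hi; rewrite nth_default ?scale0r.
Qed.

Fact whit_map_linear : linear whit_map.
Proof.
move=> c p q; pose m := maxn (size (c *: p + q)) (maxn (size p) (size q)).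
rewrite !(@whit_map_wide m) ?leq_max ?leqnn ?orbT //.
rewrite scaler_sumr -big_split; apply: eq_bigr => i _ /=.
by rewrite coefD coefZ scalerDl scalerA.
Qed.
HB.instance Definition _ := GRing.isLinear.Build C {poly C} Y *:%R whit_map whit_map_linear.

Lemma whit_mapXk k : whit_map 'X^k = whit_seq k.
Proof.
rewrite (@whit_map_wide k.+1) ?size_polyXn // big_ord_recr /= coefXn eqxx scale1r.
by rewrite big1 ?add0r // => i _; rewrite coefXn ltn_eqF ?scale0r.
Qed.

Lemma whit_map1 : whit_map 1 = v. Proof. exact: (whit_mapXk 0). Qed.

(** On powers of ['X] this is the recursion defining [whit_seq]; linearity does the rest. *)
Lemma whit_map_H p : whit_map (whit_H n eta p) = sl2_act H (whit_map p).
Proof.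
have KX k : whit_map (whit_H n eta 'X^k) = sl2_act H (whit_map 'X^k).
  rewrite whit_HXk linearD !linearZ /= !whit_mapXk /= scalerA mulfV; last first.
    by rewrite mulf_neq0 // pnatr_eq0.
  by rewrite scale1r addrA -scalerDl addrA subrK subrr scale0r add0r.
apply: (poly_span (fun p => whit_map (whit_H n eta p) = sl2_act H (whit_map p))) => //.
by move=> c q r hq hr; rewrite whit_H_linear whit_map_linear hq hr whit_map_linear sl2_act_linear.
Qed.

(* The set of [p] on which [whit_map] commutes with [T] is stable under [H] as
   soon as [T] is an eigenvector of [ad H]. *)
Lemma whit_map_eigen (l : C) (T : sl2 C) (wT : {poly C} -> {poly C}) :
  linear wT -> (forall p, whit_H n eta (wT p) - wT (whit_H n eta p) = l *: wT p) ->
  sl2_bracket H T = l *: T -> whit_map (wT 1) = sl2_act T v ->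
  forall p, whit_map (wT p) = sl2_act T (whit_map p).
Proof.
move=> lT HT bT T1.
apply: (whit_span n eta eta_neq0 (fun p => whit_map (wT p) = sl2_act T (whit_map p))).
- by move=> c p q hp hq; rewrite lT whit_map_linear hp hq whit_map_linear sl2_act_linear.
- move=> p hp; have <- := subKr (whit_H n eta (wT p)) (wT (whit_H n eta p)).
  rewrite HT whit_map_H linearB linearZ /= whit_map_H hp.
  by rewrite -sl2_act_Zl -bT sl2_act_bracket subKr.
- by rewrite whit_map1.
Qed.

(** At [1] this is the Whittaker condition on [v], because [whit_E] sends [1] to [eta]. *)
Lemma whit_map_E p : whit_map (whit_E eta p) = sl2_act E (whit_map p).
Proof.
apply: (whit_map_eigen 2); first exact: whit_E_linear.
- exact: whit_HE.
- exact: sl2_bracket_HE.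
- by rewrite /whit_E derivC subr0 linearZ /= whit_map1 Ev.
Qed.

(* On a Whittaker vector, [Omega v = H (H v) + 2 H v + 4 eta F v] determines [F v]. *)
Lemma whit_map_F p : whit_map (whit_F n eta p) = sl2_act F (whit_map p).
Proof.
apply: (whit_map_eigen (- 2)); first exact: whit_F_linear.
- exact: whit_HF.
- exact: sl2_bracket_HF.
have eta4 : 4 * eta != 0 by rewrite mulf_neq0 // pnatr_eq0.
have mapZ c p0 : whit_map (c *: p0) = c *: whit_map p0 by rewrite linearZ.
have mapB a b : whit_map (c0 *: 1 - a - 2 *: b) = c0 *: v - whit_map a - 2 *: whit_map b.
  by rewrite !linearB !linearZ /= whit_map1.
apply: (scalerI eta4); rewrite -mapZ -whit_casimir1 mapB !whit_map_H whit_map1.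
rewrite -casv casimir_act Ev sl2_actZ.
(* The bracket of [E] and [F] replaces [E (F v)] by [H v + eta F v]. *)
have /eqP := sl2_act_bracket E F v; rewrite sl2_bracket_EF Ev sl2_actZ eq_sym subr_eq.
move/eqP => ->; move: (sl2_act H (sl2_act H v)) => a.
move: (sl2_act H v) (sl2_act F v) => b f.
rewrite -[a + _ + _]addrA [a + _]addrC addrK scalerDr -[_ + _ + _]addrA.
rewrite [2 *: b + _]addrC addrACA subrr addr0 -scalerDl scalerA.
by congr (_ *: _); ring.
Qed.

Lemma whit_map_op x p : whit_map (whit_op n eta x p) = sl2_act x (whit_map p).
Proof.
rewrite {2}[x]sl2_decomp !sl2_act_linear_l sl2_act_Zl.
rewrite /whit_op (whit_map_linear (x 0 0)) (whit_map_linear (x 0 1)).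
by rewrite [whit_map (_ *: _)]linearZ /= whit_map_H whit_map_E whit_map_F.
Qed.

End Universal.

(** The isomorphism is [whit_map]. Its kernel is stable under [E] and [H], so if nonzero it contains
    [1], forcing [v = 0]. Its image is a submodule containing the generator [v]. *)
Lemma is_Y_whit_model Y : is_Y eta (n + 1) Y -> whit_model n eta Y.
Proof.
case=> [[[v0 v0_neq0] irr] [v [Ev vgen]] [chi [chic [_ chiY]]]].
(* Here [t = n + 1], so the Casimir eigenvalue becomes [n ^+ 2 + 2 * n]. *)
rewrite addrK in chic.
have casv : usl2_act (casimir C) v = c0 *: v by rewrite chiY ?chic //; apply: casimir_central.
have mapop := whit_map_op Y v Ev casv.
exists (whit_map Y v) => //; rewrite -setTT_bijective; split=> // [p q _ _ epq|y _].
- apply/eqP; rewrite -subr_eq0; apply: contraTT v0_neq0 => pq0; rewrite negbK.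
  have v_eq0 : v = 0.
    rewrite -(whit_map1 Y v); pose K p := whit_map Y v p = 0.
    apply: (whit_irreducible n eta eta_neq0 K _ _ _ (p - q) _ pq0).
    + by move=> c r s Kr Ks; rewrite /K whit_map_linear Kr Ks scaler0 addr0.
    + by move=> r Kr; rewrite /K whit_map_E // Kr sl2_act0.
    + by move=> r Kr; rewrite /K whit_map_H // Kr sl2_act0.
    + by rewrite /K linearB /= epq subrr.
  (* If [v = 0], the zero submodule contains the generator and is all of [Y], against [v0_neq0]. *)
  have /(congr1 (fun N : set Y => N v0)) : ([set 0] = setT :> set Y)%classic.
    apply: vgen => //; split=> //= [c u w -> ->|x w ->]; last exact: sl2_act0.
    by rewrite scaler0 addr0.
  by move=> e; apply/eqP; change ([set (0 : Y)]%classic v0); rewrite e.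
- have : ([set z | exists p, whit_map Y v p = z] = setT)%classic.
    apply: vgen; last by exists 1; rewrite whit_map1.
    split=> [|c u w [p <-] [q <-]|x w [p <-]].
    + by exists 0; rewrite linear0.
    + by exists (c *: p + q); rewrite linearP.
    + by exists (whit_op n eta x p); rewrite mapop.
  move/(congr1 (fun N : set Y => N y)) => e.
  have [p <-] : [set z | exists p, whit_map Y v p = z]%classic y by rewrite e.
  by exists p.
Qed.

(** Generation by [e 1] and irreducibility are transported from [whit_span] and [whit_irreducible];
    the infinitesimal character is read off from the action on [e 1]. *)
Lemma whit_model_is_Y M : whit_model n eta M -> is_Y eta (n + 1) M.
Proof.
move=> [e [g eK gK] eop].
have glin : linear g by move=> c u w; apply: (can_inj eK); rewrite linearP !gK.
have e1_neq0 : e 1 != 0.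
  by rewrite -(linear0 e) (inj_eq (can_inj eK)) oner_neq0.
have eE p : e (whit_E eta p) = sl2_act E (e p) by rewrite -eop whit_op_E.
have eH p : e (whit_H n eta p) = sl2_act H (e p) by rewrite -eop whit_op_H.
have eF p : e (whit_F n eta p) = sl2_act F (e p) by rewrite -eop whit_op_F.
have gen (N : set M) : sl2_submodule N -> N (e 1) -> N = setT%classic.
  move=> [N0 Nlin Nact] N1; apply/seteqP; split=> // u _; rewrite -(gK u).
  apply: (whit_span n eta eta_neq0 (fun p => N (e p))) => // [c p q hp hq|p hp].
    by rewrite linearP; apply: Nlin.
  by rewrite eH; apply: Nact.
have Ee1 : whittaker_vector eta (e 1).
  by rewrite /whittaker_vector -eE /whit_E derivC subr0 linearZ.
split.
- split; first by exists (e 1).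
  move=> N [N0 Nlin Nact]; have [Nz|] := pselect (forall u, N u -> u = 0).
    by left; apply/seteqP; split=> // u ->.
  move=> /existsNP[u /not_implyP[Nu /eqP u0]]; right; apply: gen => //.
  apply: (whit_irreducible n eta eta_neq0 (fun p => N (e p)) _ _ _ (g u)).
  + by move=> c p q hp hq; rewrite linearP; apply: Nlin.
  + by move=> p hp; rewrite eE; apply: Nact.
  + by move=> p hp; rewrite eH; apply: Nact.
  + by rewrite gK.
  + by apply: contraNneq u0 => gu0; rewrite -(gK u) gu0 linear0.
- by exists (e 1).
(* A central [z] maps [1] to an [eta]-Whittaker vector, hence to a constant. *)
pose chi (z : Usl2 C) := (g (usl2_act z (e 1)))`_0.
have actlin z : linear (@usl2_act C M z) := uterm_act_linear (repr z).
have chi1 z : ucentral z -> usl2_act z (e 1) = chi z *: e 1.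
  move=> zc; set u := usl2_act z _.
  have Eu : sl2_act E u = eta *: u.
    rewrite /u -usl2_act_gen -usl2_actM -zc usl2_actM usl2_act_gen Ee1.
    have := actlin z eta (e 1) 0; rewrite addr0 => ->.
    have := actlin z (- 1) 0 0; rewrite scaler0 addr0 scaleN1r addNr => ->.
    by rewrite addr0.
  (* For polynomials, [E p = eta p] says that the derivative of [p] vanishes. *)
  have du0 : (g u)^`() = 0.
    have : whit_E eta (g u) = eta *: g u by apply: (can_inj eK); rewrite eE linearZ /= gK.
    by rewrite /whit_E => /eqP; rewrite -subr_eq0 addrAC subrr add0r oppr_eq0 => /eqP.
  have gu : g u = (chi z)%:P.
    apply/polyP => -[|j]; first by rewrite coefC.
    have /eqP := congr1 (fun p : {poly C} => p`_j) du0.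
    by rewrite coef_deriv coef0 coefC -mulr_natr mulf_eq0 pnatr_eq0 orbF => /eqP.
  by rewrite -[LHS]gK gu -[_%:P]mulr1 mul_polyC linearZ.
have chiM z : ucentral z -> forall m : M, usl2_act z m = chi z *: m.
  (* As [z] is central, this eigenspace is a submodule; it contains the generator [e 1]. *)
  move=> zc m; pose N : set M := fun m => usl2_act z m = chi z *: m.
  suff NT : N = setT%classic by rewrite -/(N m) NT.
  apply: gen; last exact: chi1.
  have act0 : usl2_act z (0 : M) = 0.
    by have := actlin z (- 1) 0 0; rewrite scaler0 addr0 scaleN1r addNr.
  split=> [|c u w hu hw|x w hw]; rewrite /N ?act0 ?scaler0 //.
    by rewrite actlin hu hw scalerDr !scalerA mulrC.
  by rewrite -usl2_act_gen -usl2_actM zc usl2_actM hw !usl2_act_gen sl2_actZ.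
(* Since [e 1] is nonzero, every identity for [chi] can be checked on [e 1]. *)
have chi_scal z c : ucentral z -> usl2_act z (e 1) = c *: e 1 -> chi z = c.
  move=> zc /eqP; rewrite chi1 // -subr_eq0 -scalerBl scaler_eq0 (negbTE e1_neq0) orbF.
  by rewrite subr_eq0 => /eqP.
exists chi; split.
  rewrite addrK; apply: chi_scal; first exact: casimir_central.
  by rewrite casimir_act -eF -!eE -!eH -eF -!linearZ -!linearD whit_casimir linearZ.
split=> //; split.
- apply: chi_scal; first by move=> a; rewrite mul1r mulr1.
  by rewrite scale1r; have := uterm_actP (repr_umk (UScal (1 : C))) (e 1); rewrite /= scale1r.
- move=> y z yc zc; apply: chi_scal; first by move=> a; rewrite -mulrA zc mulrA yc mulrA.
  by rewrite usl2_actM chiM // chiM // scalerA mulrC.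
- move=> c y z yc zc; apply: chi_scal.
    by move=> a; rewrite mulrDl mulrDr -scalerAl -scalerAr yc zc.
  by rewrite usl2_actD usl2_actZ !chiM // scalerA -scalerDl.
Qed.

End WhittakerModules.

(** * Global sections of the direct image as polynomials *)

Section GlobalSectionsModel.
Context {C : numClosedFieldType}.
Implicit Types (p q : {poly C}).
Local Notation F := (ratfun C).

Lemma regular_at_poly n p (x : C * C) : x.2 != 0 -> regular_at n x (rat_poly p).
Proof.
move=> hx; apply: (regular_at_twist (n := 0) n hx).
(* With [d = size p], the denominator [1] stands for the form [x1^d], nonzero at [x]. *)
exists (size p), (size p), p, 1; rewrite rmorph1 divr1 size_poly1; split.
- by rewrite leqnSn.
- by lia.
- by rewrite bform_affine ?size_poly1 // hornerC mulr1 expf_neq0.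
- by [].
Qed.

(** In lowest terms [u / v], a nonconstant [v] has a root [a]. Regularity at [a] gives [f = p / q]
    with [q] nonzero at [a], and [u * q = p * v] makes [a] a root of [u] too, against
    coprimality. *)
Lemma regular_affine_poly n (f : F) :
  (forall a : C, regular_at n (a, 1) f) -> exists p, f = rat_poly p.
Proof.
move=> hf; have [u [v [v_neq0 uv fE]]] :
    exists u v, [/\ v != 0, coprimep u v & f = rat_poly u / rat_poly v].
  elim/rat_ind: f hf => p q q0 _; pose d := gcdp p q.
  have d0 : d != 0 by rewrite gcdp_eq0 (negbTE q0) andbF.
  have pE : p = p %/ d * d by rewrite divpK // dvdp_gcdl.
  have qE : q = q %/ d * d by rewrite divpK // dvdp_gcdr.
  have qd0 : q %/ d != 0 by apply: contraNneq q0 => e; rewrite qE e mul0r.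
  exists (p %/ d), (q %/ d); split=> //; first by rewrite coprimep_div_gcd // q0 orbT.
  by apply/eqP; rewrite rat_frac_eq // {1}pE {2}qE; apply/eqP; ring.
have [/size_poly1P[c c0 vE]|] := boolP (size v == 1).
  exists (c^-1 *: u); apply: (@mulIf _ (rat_poly v)); first by rewrite rat_poly_eq0.
  rewrite fE mulfVK ?rat_poly_eq0 // -rmorphM vE mulrC mul_polyC scalerA divff //.
  by rewrite scale1r.
move/closed_rootP => [a va]; have [d [e [p [q [[_ hq] _ q0 fE']]]]] := hf a.
have qa : q.[a] != 0.
  move: q0; rewrite bform_affine ?oner_neq0 //= divr1 expr1n mul1r //.
have := fE; rewrite fE' => /eqP; rewrite rat_frac_eq ?(bform_neq0 q0) // => /eqP.
move/(congr1 (horner^~ a)); rewrite !hornerM (rootP va) mulr0 => /esym/eqP.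
rewrite mulf_eq0 (negbTE qa) orbF => ua.
by have := coprimep_root uv ua; rewrite (rootP va) eqxx.
Qed.

(** As [T = op_sl2 n x] has order at most one, its twist stops at [T + eta (w T - T w)]. *)
Lemma op_twist_sl2 n eta x p : op_twist eta (op_sl2 n x) (rat_poly p) =
  rat_poly (whit_op n eta x p) :> F.
Proof.
rewrite (op_twistE _ _ (op_sl2_order n x)) big_ord_recr big_ord1 /= expr0 expr1 fact0 !divr1.
rewrite scale1r /opcomm /op_sl2 /op_H /op_E /op_F !rat_scaleE !rat_derivM rat_deriv_w.
rewrite rat_deriv_poly /whit_op /whit_H /whit_E /whit_F /rat_w -!mul_polyC.
have rD (a b : {poly C}) : rat_poly (a + b) = rat_poly a + rat_poly b by rewrite rmorphD.
have rN (a : {poly C}) : rat_poly (- a) = - rat_poly a by rewrite rmorphN.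
have rM (a b : {poly C}) : rat_poly (a * b) = rat_poly a * rat_poly b by rewrite rmorphM.
have rn : rat_poly (n%:~R : C)%:P = n%:~R by rewrite !rmorph_int.
have r2 : rat_poly (2 : C)%:P = 2 by rewrite !rmorph_nat.
move: (n%:~R : C)%:P (2 : C)%:P rn r2 => N T <- <-.
move: eta%:P (x 0 0)%:P (x 0 1)%:P (x 1 0)%:P p^`() => c a b d p'.
rewrite expr2 !(rD, rN, rM).
move: (rat_poly c) (rat_poly a) (rat_poly b) (rat_poly d) (rat_poly p') (rat_poly p).
move: (rat_poly N) (rat_poly T) (rat_poly 'X) => *; ring.
Qed.

(** Sections of the direct image over the whole line are functions regular on [zopen_infty C], hence
    polynomials, on which [op_twist_sl2] computes the action. *)
Lemma global_sections_whit_model (n : int) (eta : C) :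
  whit_model n eta (global_sections (direct_image n (twisted_O eta))).
Proof.
set Gamma := global_sections _; pose U : zopen_in (zopen_infty C) := trace (topX C).
have OrP p : rat_poly p \in Osec_pred 0 U.
  by apply/asboolP => y [_ hy]; apply: regular_at_poly.
pose e p : Gamma := OSections (OrP p) : Osections 0 U.
have elin : linear e.
  move=> c p q; apply: val_inj.
  by rewrite /= rmorphD -mul_polyC rmorphM.
pose e' : {linear {poly C} -> Gamma} :=
  HB.pack e (GRing.isLinear.Build C {poly C} Gamma *:%R e elin).
exists e' => [|x p].
  rewrite -setTT_bijective; split=> // [p q _ _|s _].
    by move/(congr1 (@Oval C 0 U)) => /= /eqP; rewrite tofrac_eq => /eqP.
  have [p hp] : exists p, Oval (s : Osections 0 U) = rat_poly p.
    (* The point [w = a] of the affine line is represented by [(a, 1)]. *)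
    apply: (@regular_affine_poly 0) => a; have /asboolP := valP (s : Osections 0 U).
    apply; split; first by rewrite /= xpair_eqE oner_eq0 andbF.
    exact: oner_neq0.
  by exists p => //; apply: val_inj; rewrite /= hp.
apply: val_inj; rewrite /= -op_twist_sl2; apply/esym/tO_actE.
exact: (@di_diffop C n (topX C) _ (diffop_op_sl2 n x (topX C))).
Qed.

End GlobalSectionsModel.

Theorem theorem8p5 (R : realType) (t : int) (eta : R[i])
    (t_ge1 : 1 <= t) (eta_neq0 : eta != 0) :
  let Gamma := global_sections (direct_image (t - 1) (twisted_O eta)) in
  is_Y eta t Gamma /\
  forall Y : sl2_module R[i], is_Y eta t Y -> sl2_isomorphic Gamma Y.
Proof.
(* The polynomial model with [n = t - 1] serves both claims: it gives [Gamma] the properties of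
   [is_Y], and every [Y] with these properties admits it as well. *)
have model := global_sections_whit_model (t - 1) eta.
split=> [|Y Y_is_Y]; first by have := whit_model_is_Y _ _ eta_neq0 _ model; rewrite subrK.
apply: whit_model_unique model _; apply: is_Y_whit_model => //.
by rewrite subrK.
Qed.
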